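(* Let $D$ be a finite digraph without loops (parallel arcs and pairs of opposite arcs are allowed), and let $X(D)$ be its 3-arc graph. Then $h(X(D)) \ge \chi(X(D))$, where $h$ denotes the Hadwiger number and $\chi$ the chromatic number.
   Context: A digraph $D=(V(D),A(D))$ consists of a vertex set $V(D)$ and a multiset $A(D)$ of ordered pairs (arcs) of distinct vertices; parallel arcs are allowed, loops are not. The arc $uv$ goes from $u$ (its tail) to $v$ (its head). Two vertices $x,y$ of $D$ are adjacent if there is at least one arc between them, in either direction. The 3-arc graph $X(D)$ of $D$ is the simple undirected graph with vertex set $A(D)$ (parallel arcs give distinct vertices) in which two vertices corresponding to arcs $uv$ and $xy$ are adjacent if and only if $v\neq x$, $y\neq u$, and $u,x$ are adjacent in $D$. A graph $H$ is a minor of a graph $G$ if a graph isomorphic to $H$ can be obtained from a subgraph of $G$ by contracting edges. The Hadwiger number $h(G)$ is the maximum integer $k$ such that $G$ contains the complete graph $K_k$ as a minor. *)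

(* Defs.v *)
(* [boolp] is only used to decide the minor relation. *)
From mathcomp Require Import all_boot.
From mathcomp Require Import boolp.

Set Implicit Arguments.
Unset Strict Implicit.
Unset Printing Implicit Defensive.

Record sgraph := SGraph {
  svertex :> finType;
  sedge : rel svertex;
  sedge_sym : symmetric sedge;
  sedge_irr : irreflexive sedge }.

Definition isomorphic (G H : sgraph) : Prop :=
  exists2 f : G -> H, bijective f &
    forall x y, sedge (f x) (f y) = sedge x y.

Section Complete.
Variable k : nat.
Definition complete_edge : rel 'I_k := fun i j => i != j.
Lemma complete_sym : symmetric complete_edge.
Proof. by move=> i j; rewrite /complete_edge eq_sym. Qed.
Lemma complete_irr : irreflexive complete_edge.
Proof. by move=> i; rewrite /complete_edge eqxx. Qed.
Definition complete := SGraph complete_sym complete_irr.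
End Complete.

Section Subgraph.
Variables (G : sgraph) (S : {set G}) (E : rel G).
Hypotheses (E_sym : symmetric E) (E_sub : subrel E (@sedge G)).
Definition subgraph_edge : rel {x : G | x \in S} :=
  fun x y => E (val x) (val y).
Lemma subgraph_sym : symmetric subgraph_edge.
Proof. by move=> x y; exact: E_sym. Qed.
Lemma subgraph_irr : irreflexive subgraph_edge.
Proof.
by move=> x; apply/negP => /E_sub; rewrite sedge_irr.
Qed.
(* The vertex set is [S]; pairs of [E] with an end outside [S] are dropped. *)
Definition subgraph := SGraph subgraph_sym subgraph_irr.
End Subgraph.

Section Contract.
Variables (G : sgraph) (x y : G).
Definition contract_edge : rel {z : G | z != y} := fun z w =>
  (z != w) &&
  [|| sedge (val z) (val w),
      (val z == x) && sedge y (val w)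
    | (val w == x) && sedge (val z) y].
Lemma contract_sym : symmetric contract_edge.
Proof.
move=> z w; rewrite /contract_edge eq_sym (sedge_sym (val z) (val w)).
rewrite (sedge_sym y (val w)) (sedge_sym (val z) y).
by congr (_ && (_ || _)); rewrite orbC.
Qed.
Lemma contract_irr : irreflexive contract_edge.
Proof. by move=> z; rewrite /contract_edge eqxx. Qed.
(* Meant for an edge [xy]: [y] is deleted and [x] plays the role of the vertex
   obtained by identifying [x] and [y]; loops and multiplicities are dropped. *)
Definition contract := SGraph contract_sym contract_irr.
End Contract.

Inductive contracts (G : sgraph) : sgraph -> Prop :=
| contracts_refl : contracts G G
| contracts_step (H : sgraph) (x y : H) :
    contracts G H -> sedge x y -> contracts G (contract x y).

Definition minor (H G : sgraph) : Prop :=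
  exists (S : {set G}) (E : rel G) (E_sym : symmetric E)
         (E_sub : subrel E (@sedge G)) (K : sgraph),
    contracts (subgraph S E_sym E_sub) K /\ isomorphic H K.

Definition has_complete_minor (G : sgraph) : pred nat :=
  fun k => `[< minor (complete k) G >].

Lemma has_complete_minor_ex (G : sgraph) : exists k, has_complete_minor G k.
Proof.
exists 0; apply/asboolP; exists set0, (@sedge G), (@sedge_sym G).
exists (fun _ _ h => h); eexists; split; first exact: contracts_refl.
have F (z : {x : G | x \in set0}) : False by case: z => x; rewrite inE.
exists (fun i : 'I_0 => match notF (ltn_ord i) with end).
  by exists (fun z => match F z with end) => [[]|z] //; case: (F z).
by case.
Qed.

Lemma has_complete_minor_le (G : sgraph) (k : nat) :
  has_complete_minor G k -> k <= #|G|.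
Proof.
move=> /asboolP[S [E [E_sym [E_sub [K [GK [f f_bij _]]]]]]].
rewrite -{1}(card_ord k) (bij_eq_card f_bij).
have {f f_bij} leK : #|K| <= #|subgraph S E_sym E_sub|.
  elim: GK => // H x y _ leH _; apply: leq_trans leH.
  exact: (leq_card val val_inj).
by apply: leq_trans leK _; exact: (leq_card val val_inj).
Qed.

Definition hadwiger_number (G : sgraph) : nat :=
  ex_maxn (has_complete_minor_ex G) (@has_complete_minor_le G).

Definition colorable (G : sgraph) : pred nat := fun k =>
  [exists f : {ffun G -> 'I_k},
    [forall x, forall y, sedge x y ==> (f x != f y)]].

Lemma colorable_ex (G : sgraph) : exists k, colorable G k.
Proof.
exists #|G|; apply/existsP; exists [ffun x => enum_rank x].
apply/forallP => x; apply/forallP => y; apply/implyP => xy; rewrite !ffunE.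
by apply: contraTneq xy => /enum_rank_inj ->; rewrite sedge_irr.
Qed.

Definition chromatic_number (G : sgraph) : nat := ex_minn (colorable_ex G).

(* Arcs form a type of their own, so that parallel arcs are distinct. *)
Record digraph := Digraph {
  dvertex : finType;
  arc : finType;
  arc_tail : arc -> dvertex;
  arc_head : arc -> dvertex;
  loopless : forall a, arc_tail a != arc_head a }.

Definition dadjacent (D : digraph) : rel (dvertex D) := fun u v =>
  [exists a : arc D, ((arc_tail a == u) && (arc_head a == v))
                  || ((arc_tail a == v) && (arc_head a == u))].

Section ThreeArc.
Variable D : digraph.
Definition three_arc_edge : rel (arc D) := fun a b =>
  [&& arc_head a != arc_tail b, arc_head b != arc_tail a & dadjacent (arc_tail a) (arc_tail b)].
Lemma three_arc_sym : symmetric three_arc_edge.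
Proof.
move=> a b; rewrite /three_arc_edge andbCA; congr [&& _, _ & _].
by apply: eq_existsb => c; rewrite orbC.
Qed.
Lemma three_arc_irr : irreflexive three_arc_edge.
Proof.
move=> a; apply/and3P => -[_ _ /existsP[c]]; rewrite orbb.
by case/andP=> /eqP tc /eqP hc; move: (loopless c); rewrite tc hc eqxx.
Qed.
Definition three_arc_graph := SGraph three_arc_sym three_arc_irr.
End ThreeArc.

(* Submission.v *)
(** Put [k + 1 = chi(X(D))] and work with arcs as pairs of vertices.  Call [u], [v]
    core-adjacent if they are adjacent and some arc from each avoids the other; colouring
    an arc by its tail turns a colouring of the core graph into one of [X(D)].  For
    [k <= 3] minimum degree [k] already forces a [K_(k+1)] minor.  For [3 < k], let [R] be
    a maximal independent set of core vertices of degree at most [k] all of whose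
    out-neighbours are core neighbours.  A [k]-colouring of the core graph outside [R]
    extends to [X(D)]: arcs with tail [r] in [R] get a colour missing around [r], or, if
    none is missing, the colour of their head.  So there is a [k]-critical set [H] avoiding
    [R], and its vertices have many core neighbours or an out-neighbour that is not one.
    Arcs leaving one vertex [u], or the two ends of a core edge, paired with arcs whose
    tails are neighbours of these hubs, give branch sets of a [K_(k+1)] minor as soon as
    some out-degree is at least [k] or some core arc [(u, x)] has out-degree sum larger
    than [k] (digons and some small cases excepted).  If none of these applies, weighing
    the arcs inside [H] shows that [H] is [k]-regular, closed under out-neighbours and free
    of digons; by Brooks' theorem it spans a regular tournament on [k + 1] vertices.  Its
    adjacency matrix is invertible, so it contains a permutation [f] along arcs, and the arcs
    [(f u, f (f u))] and [(u, g u)], with [g u] an out-neighbour of [u] other than [f u],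
    form the branch sets of a [K_(k+1)] minor. *)
Require Import Defs.
From mathcomp Require Import all_boot all_fingroup all_algebra.
From mathcomp Require Import zify.
From mathcomp Require Import boolp.

Set Implicit Arguments.
Unset Strict Implicit.
Unset Printing Implicit Defensive.

(** * Models of complete graphs *)

Definition connected_in (T : finType) (e : rel T) (A : {set T}) :=
  {in A &, forall x y, connect [rel a b in A | e a b] x y}.

Definition kmodel (T : finType) (e : rel T) (I : finType) (B : I -> {set T}) :=
  [/\ forall i, B i != set0,
      forall i, connected_in e (B i),
      forall i j x, x \in B i -> x \in B j -> i = j
    & forall i j, i != j -> exists x y, [/\ x \in B i, y \in B j & e x y]].

Lemma connect_map (T T' : finType) (e : rel T) (e' : rel T') (h : T -> T') :
  (forall x y, e x y -> connect e' (h x) (h y)) ->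
  forall x y, connect e x y -> connect e' (h x) (h y).
Proof.
move=> he x y /connectP[p]; elim: p x => [|z p IHp] x /= => [_ -> //|].
by case/andP=> xz zp yE; apply: connect_trans (he _ _ xz) (IHp _ zp yE).
Qed.

(** [phi] names the branch set of each vertex. As long as two vertices share a label, connectedness
    supplies an edge inside a class; contracting it preserves the three conditions and removes a
    vertex. Once [phi] is injective all pairs of vertices are adjacent. *)
Lemma labelling_contracts (I : finType) (G0 G : sgraph) (phi : G -> I) :
    contracts G0 G ->
    (forall i, exists x, phi x = i) ->
    (forall x y, phi x = phi y ->
       connect [rel a b | sedge a b && (phi a == phi b)] x y) ->
    (forall i j, i != j -> exists x y, [/\ phi x = i, phi y = j & sedge x y]) ->
  exists K, contracts G0 K /\ isomorphic (complete #|I|) K.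
Proof.
have [n] := ubnP #|G|; elim: n G phi => // n IHn G phi leGn GG phi_surj phi_conn phi_adj.
have [/injectiveP phi_inj | /injectivePn[x [y xy phi_xy]]] := boolP (injectiveb phi).
  have [psi phiK psiK] : bijective phi.
    apply: inj_card_bij => //; rewrite -(card_codom phi_inj).
    by apply/subset_leq_card/subsetP=> i _; have [x <-] := phi_surj i; apply: codom_f.
  exists G; split=> //; exists (psi \o enum_val).
    apply: bij_comp; first by exists phi.
    exact: enum_val_bij.
  move=> i j /=; rewrite /complete_edge.
  have [-> | ij] := eqVneq i j; first by rewrite sedge_irr.
  have [|a [b [ai bj ab]]] := phi_adj (enum_val i) (enum_val j).
    by rewrite (inj_eq enum_val_inj).
  by rewrite -ai -bj !phiK ab.
have [z [xz phi_xz]] : exists z, sedge x z /\ phi x = phi z.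
  have /connectP[[|z p] /=] := phi_conn _ _ phi_xy.
    by move=> _ yx; rewrite yx eqxx in xy.
  by case/andP=> /andP[xz /eqP phi_xz] _ _; exists z.
have x_z : x != z by apply: contraTneq xz => ->; rewrite sedge_irr.
pose G' := contract x z.
pose x' : G' := Sub x x_z.
(* Only [z] lies outside the subtype, so the default value [x'] makes [h] the contraction map. *)
pose h (w : G) : G' := insubd x' w.
have hz : h z = x' by rewrite /h /insubd insubF ?eqxx.
have hE w : w != z -> val (h w) = w by move=> wz; rewrite val_insubd wz.
have phi_h w : phi (val (h w)) = phi w.
  by have [-> | /hE-> //] := eqVneq w z; rewrite hz.
have h_val (w : G') : h (val w) = w by apply: val_inj; rewrite hE // (valP w).
have h_edge a b : sedge a b -> h a != h b -> sedge (h a) (h b).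
  move=> ab hab; rewrite /= /contract_edge hab /=.
  have [az | az] := eqVneq a z; have [bz | bz] := eqVneq b z.
  - by rewrite az bz eqxx in hab.
  - by rewrite az hz /= eqxx /= hE // -az ab orbT.
  - by rewrite bz hz /= eqxx /= hE // -bz ab !orbT.
  - by rewrite !hE // ab.
apply: (IHn G' (phi \o val)).
- rewrite ltnS in leGn; apply: leq_trans leGn.
  by rewrite card_sig -(cardC (pred1 z)) card1 add1n ltnS; apply/subset_leq_card/subsetP.
- exact: contracts_step.
- by move=> i; have [w <-] := phi_surj i; exists (h w); rewrite /= phi_h.
- move=> a b /phi_conn ab; rewrite -(h_val a) -(h_val b).
  apply: connect_map ab => {}a {}b /andP[ab /eqP phi_ab].
  have [-> | hab] := eqVneq (h a) (h b); first exact: connect0.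
  by apply: connect1; apply/andP; split; [exact: h_edge | rewrite /= !phi_h phi_ab].
- move=> i j ij; have [a [b [ai bj ab]]] := phi_adj _ _ ij.
  exists (h a), (h b); rewrite /= !phi_h; split=> //; apply: h_edge => //.
  by apply: contraNneq ij => /(congr1 (phi \o val)) /=; rewrite !phi_h ai bj => ->.
Qed.

Lemma kmodel_minor (G : sgraph) (I : finType) (B : I -> {set G}) :
  kmodel (@sedge G) B -> minor (complete #|I|) G.
Proof.
case=> B_n0 B_conn B_inj B_adj.
pose S := \bigcup_i B i.
exists S, (@sedge G), (@sedge_sym G), (fun _ _ => id).
set G0 := subgraph _ _ _.
have phiP (x : G0) : {i | val x \in B i}.
  by apply: sigW; have /bigcupP[i _ xi] := valP x; exists i.
have memS i x : x \in B i -> x \in S by move=> xi; apply/bigcupP; exists i.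
apply: (@labelling_contracts I G0 G0 (fun x => sval (phiP x))); first exact: contracts_refl.
- move=> i; have /set0Pn[x xi] := B_n0 i.
  exists (Sub x (memS i x xi)); case: (phiP _) => j /= xj.
  exact: B_inj xj xi.
- move=> x y; case: (phiP x) (phiP y) => i /= xi [j /= yj] ij.
  rewrite -{j}ij in yj.
  have {yj}/connectP[p] := B_conn i _ _ xi yj.
  elim: p x xi => [|z p IHp] x xi /= => [_ /val_inj-> // |].
  case/andP=> /andP[/andP[_ zi] xz] zp yE.
  apply: connect_trans (IHp (Sub z (memS i z zi)) zi zp yE).
  apply: connect1 => /=; apply/andP; split=> //.
  case: (phiP x) => j /= xj; case: (phiP _) => l /= zl.
  by rewrite /= (B_inj _ _ _ xj xi) (B_inj _ _ _ zl zi).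
- move=> i j /B_adj[x [y [xi yj xy]]].
  exists (Sub x (memS i x xi)), (Sub y (memS j y yj)); split=> //.
    by case: (phiP _) => l /= xl; apply: B_inj xl xi.
  by case: (phiP _) => l /= yl; apply: B_inj yl yj.
Qed.

Definition has_kmodel (T : finType) (e : rel T) n :=
  exists (I : finType) (B : I -> {set T}), #|I| = n /\ kmodel e B.

Lemma has_kmodel_minor (G : sgraph) n :
  has_kmodel (@sedge G) n -> minor (complete n) G.
Proof. by case=> I [B [<- /kmodel_minor]]. Qed.

Lemma connected_in1 (T : finType) (e : rel T) x : connected_in e [set x].
Proof. by move=> a b /set1P-> /set1P->. Qed.

Lemma connected_in2 (T : finType) (e : rel T) x y :
  symmetric e -> e x y -> connected_in e [set x; y].
Proof.
move=> e_sym xy.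
have C a b : a \in [set x; y] -> b \in [set x; y] -> e a b ->
    connect [rel a b in [set x; y] | e a b] a b.
  by move=> ai bi ab; apply: connect1; rewrite /= ai bi.
by move=> a b; case/set2P=> ->; case/set2P=> ->;
   rewrite ?connect0 // C ?set21 ?set22 // e_sym.
Qed.

(** * Critical sets and small chromatic numbers *)

Definition nbr (T : finType) (e : rel T) (S : {set T}) x := [set y in S | e x y].

Definition proper_on (T : finType) (e : rel T) k (S : {set T}) (c : T -> 'I_k) :=
  {in S &, forall x y, e x y -> c x != c y}.

Definition kcol (T : finType) (e : rel T) k (S : {set T}) :=
  [exists c : {ffun T -> 'I_k},
    [forall x in S, forall y in S, e x y ==> (c x != c y)]].

(** Removing single vertices is enough for minimality, as colourability passes to subsets. *)
Definition crit (T : finType) (e : rel T) k (S : {set T}) :=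
  ~~ kcol e k S /\ forall x, x \in S -> kcol e k (S :\ x).

Section Colour.
Variables (T : finType) (e : rel T) (k : nat).
Hypotheses (e_sym : symmetric e) (e_irr : irreflexive e).
Implicit Types (S H : {set T}) (c : T -> 'I_k).

Lemma kcolP S : reflect (exists c, proper_on e S c) (kcol e k S).
Proof.
apply: (iffP existsP) => [[c /forall_inP cP]|[c cP]].
  by exists c => x y xS yS; move/(_ x xS)/forall_inP/(_ y yS)/implyP: cP.
exists [ffun x => c x]; apply/forall_inP=> x xS; apply/forall_inP=> y yS.
by apply/implyP; rewrite !ffunE; apply: cP.
Qed.

Lemma proper_onS S H c : S \subset H -> proper_on e H c -> proper_on e S c.
Proof. by move=> /subsetP SH cP x y /SH xH /SH; apply: cP. Qed.

Lemma kcolS S H : S \subset H -> kcol e k H -> kcol e k S.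
Proof. by move=> SH /kcolP[c cP]; apply/kcolP; exists c; apply: proper_onS cP. Qed.

Lemma crit_exists S : ~~ kcol e k S -> exists2 H : {set T}, H \subset S & crit e k H.
Proof.
case/(@minset_exists _ (fun A => ~~ kcol e k A)) => H /minsetP[nH minH] HS.
exists H => //; split=> // x xH; apply: contraT => nx.
have := minH _ nx (subsetDl _ _) => /setP/(_ x).
by rewrite !inE eqxx xH.
Qed.

Lemma crit_proper H S : crit e k H -> S \proper H -> exists c, proper_on e S c.
Proof.
move=> [_ minH] /properP[SH [x xH xS]]; apply/kcolP; apply: kcolS (minH x xH).
by apply/subsetP=> y yS; rewrite !inE (subsetP SH) // andbT; apply: contraNneq xS => <-.
Qed.

Lemma missing_colour (A : {set 'I_k}) : #|A| < k -> exists i, i \notin A.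
Proof.
move=> ltAk; suff /set0Pn[i] : ~: A != set0 by rewrite inE; exists i.
by rewrite -card_gt0 cardsCs setCK card_ord subn_gt0.
Qed.

(** The hypothesis counts the colours seen by [x] and not its neighbours, so that two neighbours of
    the same colour can be exploited. *)
Lemma proper_ext S c x : proper_on e S c -> #|c @: nbr e S x| < k ->
  exists c', [/\ proper_on e (x |: S) c' & forall y, y != x -> c' y = c y].
Proof.
move=> cP /missing_colour[i iP]; exists (fun y => if y == x then i else c y); split.
  have iN z : z \in S -> e x z -> c z != i.
    by move=> zS xz; apply: contraNneq iP => <-; apply: imset_f; rewrite inE zS.
  move=> y z; rewrite !inE; case: (eqVneq y x) => [->|yx] /= yS; last first.
    case: (eqVneq z x) => [-> _|zx /= zS]; last exact: cP.
    by rewrite e_sym; apply: iN.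
  case: (eqVneq z x) => [->|zx /= zS xz]; first by rewrite e_irr.
  by rewrite eq_sym iN.
by move=> y /negPf->.
Qed.

Lemma crit_deg H x : crit e k H -> x \in H -> k <= #|nbr e H x|.
Proof.
move=> [nH minH] xH; rewrite leqNgt; apply: contra nH => ltk.
have /kcolP[c cP] := minH x xH; apply/kcolP.
have [|c' [c'P _]] := proper_ext (x := x) cP.
  apply: leq_ltn_trans (leq_imset_card _ _) _; apply: leq_ltn_trans ltk.
  by apply: subset_leq_card; apply/subsetP=> y; rewrite !inE => /andP[/andP[_ ->]].
by exists c'; rewrite setD1K in c'P.
Qed.

End Colour.

Lemma min_natP (P : nat -> Prop) :
  (exists n, P n) -> exists2 n, P n & forall m, P m -> n <= m.
Proof.
move=> exP; have exPb : exists n, `[< P n >] by have [n /asboolP] := exP; exists n.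
case: (ex_minnP exPb) => n /asboolP Pn minn.
by exists n => // m Pm; apply: minn; apply/asboolP.
Qed.

Lemma max_natP (P : nat -> Prop) b : (exists n, P n) -> (forall n, P n -> n <= b) ->
  exists2 n, P n & forall m, P m -> m <= n.
Proof.
move=> exP ubP; have exPb : exists n, `[< P n >] by have [n /asboolP] := exP; exists n.
case: (@ex_maxnP _ b exPb) => [n /asboolP/ubP //|n /asboolP Pn maxn].
by exists n => // m Pm; apply: maxn; apply/asboolP.
Qed.

Section LongestPath.
Variables (T : finType) (e : rel T) (x0 : T).
Hypotheses (e_sym : symmetric e) (e_irr : irreflexive e).
Implicit Types (s : seq T) (H : {set T}).
Local Notation "s ^ i" := (nth x0 s i).

Definition interval s a b := [set s ^ (val l) | l : 'I_(size s) & a <= l < b].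

Lemma intervalP s a b x :
  reflect (exists l, [/\ l < size s, a <= l < b & x = s ^ l]) (x \in interval s a b).
Proof.
apply: (iffP imsetP) => [[l]|[l [ls lab ->]]]; first by rewrite inE; exists l.
by exists (Ordinal ls); rewrite ?inE.
Qed.

Lemma connected_interval s a b : sorted e s -> connected_in e (interval s a b).
Proof.
move=> s_path; pose r := [rel x y in interval s a b | e x y]; rewrite /connected_in -/r.
have r_sym : connect_sym r.
  by apply: sym_connect_sym => x y /=; rewrite e_sym; congr (_ && _); rewrite andbC.
have up l m : a <= l -> l <= m -> m < b -> m < size s -> connect r (s ^ l) (s ^ m).
  move=> al; elim: m => [|m IHm]; first by rewrite leqn0 => /eqP->; rewrite connect0.
  rewrite leq_eqVlt => /predU1P[-> | lm mb ms]; first by rewrite connect0.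
  apply: connect_trans (IHm _ _ _) _; [lia | lia | lia |].
  apply: connect1 => /=; apply/andP; split; last exact: (sortedP x0 s_path).
  by apply/andP; split; apply/intervalP; [exists m | exists m.+1]; split=> //; lia.
move=> x y /intervalP[l [ls lab ->]] /intervalP[m [ms mab ->]].
by case: (leqP l m) => lm; [|rewrite r_sym]; apply: up; lia.
Qed.

(** The path is cut at positions [c 0], ..., [c n] into consecutive segments, which serve as branch
    sets. Neighbouring segments are joined by an edge of the path, so only pairs further apart need
    a chord. *)
Lemma cut_model s n (c : nat -> nat) :
    sorted e s -> uniq s -> (forall a, a < n -> c a < c a.+1) -> c n <= size s ->
    (forall a b, a.+1 < b < n ->
       exists l m, [/\ c a <= l < c a.+1, c b <= m < c b.+1 & e (s ^ l) (s ^ m)]) ->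
  has_kmodel e n.
Proof.
move=> s_path s_uniq c_incr cn c_adj.
have c_mono a b : a <= b -> b <= n -> c a <= c b.
  move=> ab bn; elim: b ab bn => [|b IHb]; first by rewrite leqn0 => /eqP->.
  rewrite leq_eqVlt => /predU1P[-> // | ab bn].
  by apply: leq_trans (IHb _ (ltnW bn)) (ltnW (c_incr b bn)).
have cs a l : a < n -> c a <= l < c a.+1 -> l < size s.
  by move=> an /andP[_ lc]; apply: leq_trans lc (leq_trans (c_mono _ _ an _) cn).
pose B (a : 'I_n) := interval s (c a) (c a.+1).
have memB (a : 'I_n) l : c a <= l < c a.+1 -> s ^ l \in B a.
  by move=> lc; apply/intervalP; exists l; split=> //; apply: cs lc.
have adj (a b : 'I_n) : a < b -> exists x y, [/\ x \in B a, y \in B b & e x y].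
  move=> ab; have bn := ltn_ord b; have an := ltn_ord a.
  have [ab1 | ab1] := ltnP a.+1 b.
    have [|l [m [lc mc lm]]] := c_adj a b; first by rewrite ab1.
    by exists (s ^ l), (s ^ m); split; rewrite ?memB.
  have {ab ab1} bE : val b = a.+1 by apply/eqP; rewrite eqn_leq ab1.
  have := c_incr a an; have := c_incr b bn; rewrite bE => lt1 lt2.
  exists (s ^ (c a.+1).-1), (s ^ (c a.+1)); split.
  - by apply: memB; lia.
  - by apply: memB; rewrite bE; lia.
  - have lts : c a.+1 < size s by apply: leq_trans lt1 (leq_trans (c_mono _ _ _ _) cn); rewrite -?bE.
    have := sortedP x0 s_path (c a.+1).-1; rewrite prednK; last by lia.
    exact.
exists _, B; split; first by rewrite card_ord.
split.
- by move=> a; apply/set0Pn; exists (s ^ (c a)); rewrite memB // leqnn c_incr.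
- by move=> a; apply: connected_interval.
- move=> a b x /intervalP[l [ls lc ->]] /intervalP[m [ms mc /eqP]].
  rewrite nth_uniq // => /eqP lm; subst m.
  clear -mc lc c_mono; have an := ltn_ord a; have bn := ltn_ord b.
  case: (ltngtP a b) => [ab | ba | /val_inj //].
    by have := c_mono a.+1 b ab (ltnW bn); lia.
  by have := c_mono b.+1 a ba (ltnW an); lia.
- move=> a b ab; have [/adj // | ba | abE] := ltngtP a b.
    by have [x [y [xa yb xy]]] := adj _ _ ba; exists y, x; split; rewrite // e_sym.
  by rewrite (val_inj abE) eqxx in ab.
Qed.

Definition hpath H s := [&& sorted e s, uniq s & all (mem H) s].
Definition longest H s := hpath H s /\ forall s', hpath H s' -> size s' <= size s.

Lemma longest_exists H x : x \in H -> exists2 s, longest H s & 0 < size s.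
Proof.
move=> xH; have [| n /asboolP/asboolP|] := @max_natP (fun n => exists2 s, hpath H s & size s = n) #|T|.
- by exists 1, [:: x] => //; rewrite /hpath /= xH.
- by case=> s /and3P[_ s_uniq _] <-; rewrite -(card_uniqP s_uniq) max_card.
move=> n [s sP sn] maxn; exists s.
  by split=> // s' s'P; rewrite sn; apply: maxn; exists s'.
by rewrite sn; apply: maxn; exists [:: x] => //; rewrite /hpath /= xH.
Qed.

(** A neighbour off the path could be put in front of it. *)
Lemma longest_nbr H s y : longest H s -> 0 < size s -> y \in H -> e (s ^ 0) y ->
  exists2 i, 0 < i < size s & y = s ^ i.
Proof.
case: s => // x s [/and3P[xs us Hs] maxs] _ yH xy.
have [ys | ys] := boolP (y \in x :: s).
  exists (index y (x :: s)); last by rewrite nth_index.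
  rewrite index_mem ys andbT lt0n; apply: contraTneq xy => y0.
  by rewrite -(nth_index x0 ys) y0 e_irr.
have := maxs (y :: x :: s); rewrite /hpath /= (negPf ys) /= e_sym xy yH.
by move: xs us Hs => /= -> /= -> -> /(_ isT); rewrite ltnn.
Qed.

Lemma longest_nbr2 H s d : longest H s -> 0 < size s -> d.+1 < #|nbr e H (s ^ 0)| ->
  exists l : seq nat, [/\ uniq l, size l = d.+1 & forall i, i \in l -> 1 < i < size s /\ e (s ^ 0) (s ^ i)].
Proof.
move=> sP s0 dP.
have : d.+1 <= #|nbr e H (s ^ 0) :\ s ^ 1|.
  by have := cardsD1 (s ^ 1) (nbr e H (s ^ 0)); case: (_ \in _) => /=; lia.
case/card_geqP=> r [r_uniq r_size r_sub].
have rP y : y \in r -> [/\ 1 < index y s, y \in s & e (s ^ 0) y].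
  move/r_sub; rewrite !inE => /and3P[ys1 yH sy].
  have [i /andP[i0 is_] yE] := longest_nbr sP s0 yH sy.
  case: sP => /and3P[_ us _] _.
  rewrite yE index_uniq // mem_nth //; split=> //; last by rewrite -yE.
  by rewrite ltn_neqAle i0 andbT; apply: contraNneq ys1 => i1; rewrite yE -i1.
exists [seq index y s | y <- r]; split; rewrite ?size_map //.
  rewrite map_inj_in_uniq // => y z /rP[_ ys _] /rP[_ zs _] yz.
  by rewrite -(nth_index x0 ys) yz nth_index.
move=> _ /mapP[y /rP[yi ys sy] ->]; rewrite index_mem ys nth_index // .
by rewrite yi.
Qed.

(** The first vertex has two neighbours at positions beyond 1; both positions are at least [i] and
    only one of them can equal [i]. *)
Lemma second_nbrs H s d i : longest H s -> 0 < size s -> d.+1 < #|nbr e H (s ^ 0)| ->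
    (forall s' j, longest H s' -> 0 < size s' -> 1 < j < size s' ->
       e (s' ^ 0) (s' ^ j) -> i <= j) ->
  0 < d -> exists2 j, i < j < size s & e (s ^ 0) (s ^ j).
Proof.
move=> sP s0 deg mini; case/(longest_nbr2 sP s0): deg => -[|a [|b l]] [us] //= [ld] lP; first by rewrite -ld.
have [|a1 ea] := lP a; rewrite ?inE ?eqxx //.
have [|b1 eb] := lP b; rewrite ?inE ?eqxx ?orbT //.
have := mini s a sP s0 a1 ea; have := mini s b sP s0 b1 eb.
rewrite leq_eqVlt => /predU1P[ib | ib] ia; last by exists b => //; rewrite ib; case/andP: b1.
exists a => //; case/andP: a1 => _ ->; rewrite andbT ltn_neqAle ia andbT ib.
by case/andP: us; rewrite inE negb_or eq_sym => /andP[].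
Qed.

(** A Pósa rotation: the chord from the first vertex to position [i] replaces the edge between
    positions [i - 1] and [i]. *)
Lemma rotate_longest H s i : longest H s -> 1 < i < size s -> e (s ^ 0) (s ^ i) ->
  longest H (rev (take i s) ++ drop i s).
Proof.
case=> /and3P[s_path us Hs] maxs /andP[i1 is_] ei.
have s_perm : perm_eq (rev (take i s) ++ drop i s) s.
  by rewrite -[X in perm_eq _ X](cat_take_drop i s) perm_cat2r perm_rev.
split; last by move=> s' /maxs; rewrite (perm_size s_perm).
apply/and3P; split; last 2 first.
- by rewrite (perm_uniq s_perm).
- by rewrite (perm_all _ s_perm).
apply/(sortedP x0) => l; rewrite (perm_size s_perm) => ls.
have it : size (take i s) = i by rewrite size_takel //; lia.
have r_lo m : m < i -> (rev (take i s) ++ drop i s) ^ m = s ^ (i - m.+1).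
  by move=> mi; rewrite nth_cat size_rev it mi nth_rev it // nth_take //; lia.
have r_hi m : i <= m -> (rev (take i s) ++ drop i s) ^ m = s ^ m.
  by move=> im; rewrite nth_cat size_rev it ltnNge im nth_drop subnKC.
have [li | il] := ltnP l.+1 i.
  rewrite !r_lo ?(ltnW li) // e_sym; have := sortedP x0 s_path (i - l.+2).
  by rewrite -subSn // subSS; apply; lia.
have [il' | li] := leqP i l; first by rewrite !r_hi ?(leqW il') //; apply: (sortedP x0).
have iE : l.+1 = i by lia.
by rewrite r_lo // r_hi ?iE // subnn.
Qed.

Lemma kmodel_small H k : k <= 3 -> H != set0 ->
  (forall x, x \in H -> k <= #|nbr e H x|) -> has_kmodel e k.+1.
Proof.
move=> k3 /set0Pn[h hH] deg; have [s sP s0] := longest_exists hH.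
have degs s' : longest H s' -> 0 < size s' -> k <= #|nbr e H (s' ^ 0)|.
  move=> [/and3P[_ _ /allP Hs'] _] s'0; apply: deg; apply: Hs'.
  exact: mem_nth.
have [/and3P[s_path us Hs] _] := sP.
case: k k3 deg degs => [|[|[|[|//]]]] _ deg degs.
- by apply: (@cut_model s 1 id) => // a b; lia.
- have /card_gt0P[y] := degs s sP s0; rewrite inE => /andP[yH sy].
  have [i /andP[i0 is_] _] := longest_nbr sP s0 yH sy.
  apply: (@cut_model s 2 id) => //; last by move=> a b; lia.
  by apply: leq_ltn_trans is_.
- have [l [_ ls iP]] := longest_nbr2 sP s0 (degs s sP s0).
  case: l ls iP => [|i [|]] //= _ iP.
  have [|/andP[i1 is_] ei] := iP i; first by rewrite inE.
  apply: (@cut_model s 3 (nth 0 [:: 0; 1; i; i.+1])) => //.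
    by case=> [|[|[|]]] //= _; lia.
  case=> [|a] [|[|[|b]]] //=; try lia.
  by exists 0, i; split; rewrite ?leqnn.
(* Among all longest paths take one whose first vertex has a neighbour at the least
   position [i > 1].  Rotating at [i] makes the vertex at position [i - 1] the first of
   another longest path, so by minimality it too has a neighbour beyond [i]. *)
have := @min_natP (fun i => exists s, [/\ longest H s, 0 < size s, 1 < i < size s & e (s ^ 0) (s ^ i)]).
case=> [|i [s' [sP' s0' i1 ei]] mini].
  have [l [_ ls iP]] := longest_nbr2 sP s0 (ltnW (degs s sP s0)).
  case: l ls iP => [|i l] //= _ iP.
  by have [|i1 ei] := iP i; [rewrite inE eqxx | exists i, s].
have {}mini s1 j : longest H s1 -> 0 < size s1 -> 1 < j < size s1 -> e (s1 ^ 0) (s1 ^ j) -> i <= j.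
  by move=> *; apply: mini; exists s1.
move: s' sP' s0' i1 ei => {}s {}sP {}s0 i1 ei {s_path us Hs}.
have [/and3P[s_path us Hs] _] := sP.
have [j /andP[ij js] ej] := second_nbrs sP s0 (degs s sP s0) mini isT.
have rP := rotate_longest sP i1 ei; set r := _ ++ _ in rP.
have rs : size r = size s by rewrite size_cat size_rev -size_cat cat_take_drop.
have r0 : 0 < size r by rewrite rs.
have [m /andP[im ms] em] := second_nbrs rP r0 (degs r rP r0) mini isT.
have it : size (take i s) = i by rewrite size_takel //; lia.
have rm : r ^ m = s ^ m by rewrite nth_cat size_rev it ltnNge (ltnW im) /= nth_drop subnKC // ltnW.
have r00 : r ^ 0 = s ^ i.-1.
  rewrite nth_cat size_rev it; case: ifP => [_|]; last by lia.
  by rewrite nth_rev it ?nth_take //; [congr nth|..]; lia.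
rewrite {}rm {}r00 {}rs in em ms.
(* The chords from position 0 to [i], from 0 to [j] and from [i - 1] to [m] join the non-consecutive
   segments; the last segment runs from the smaller to the larger of [j] and [m], so it contains
   both. *)
apply: (@cut_model s 4 (nth 0 [:: 0; 1; i; minn j m; (maxn j m).+1])) => //.
- by case=> [|[|[|[|]]]] //= _; lia.
- by rewrite /=; lia.
case=> [|[|a]] [|[|[|[|b]]]] //=; try lia; move=> _.
- by exists 0, i; split=> //; lia.
- by exists 0, j; split=> //; lia.
- by exists i.-1, m; split=> //; lia.
Qed.

End LongestPath.

(** * Linkings *)

Lemma exists_subset_card (T : finType) (A : {set T}) n :
  n <= #|A| -> exists2 B : {set T}, B \subset A & #|B| = n.
Proof.
case/card_geqP=> s [s_uniq <- sA]; exists [set x in s].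
  by apply/subsetP=> x; rewrite inE; apply: sA.
by rewrite cardsE; apply/card_uniqP.
Qed.

Section Linking.
Variables (V : finType) (S W : {set V}) (f : V).

(** A recipe for branch sets around a hub: [y] stands for the arc from the hub to [y], and [l y] for
    the tail of a second arc put with it. A hub arc misses a second arc only if its head is that
    tail, so the last clause makes any two sets touch. [y0] gets no second arc, and [f] is a head
    that must not be left in this way. *)
Definition is_linking (y0 : V) (l : V -> V) :=
  [/\ y0 \in S, y0 != f,
      {in S :\ y0, forall y, l y \in W /\ l y != y},
      {in S :\ y0 &, injective l}
    & {in S &, forall y y', y != y' ->
         (y' != y0 /\ y != l y') \/ (y != y0 /\ y' != l y)}].

(** List [S] without [y0] with the members of [W] first, list [W] starting with some [e1] outside
    [S], and match positions. The shift by one sends each member of [S] to an earlier one or out of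
    [S], so [l] has neither fixed points nor 2-cycles. *)
Lemma linking_acyclic : #|S| = #|W|.+1 -> ~~ (W \subset S) ->
  exists y0 l, is_linking y0 l.
Proof.
move=> cS nWS.
have [e1 e1WS] : exists e1, e1 \in W :\: S.
  by apply/set0Pn; rewrite setD_eq0.
have cSW : #|S :\: W| = #|W :\: S|.+1.
  by have := cardsID W S; have := cardsID S W; rewrite setIC cS; lia.
have [y0] : exists y0, y0 \in (S :\: W) :\ f.
  apply/set0Pn; rewrite -card_gt0; have := cardsD1 f (S :\: W).
  have := cardsD1 e1 (W :\: S); rewrite e1WS cSW; case: (_ \in _) => /=; lia.
rewrite !inE => /and3P[y0f y0W y0S].
pose B := enum (W :&: S); pose D := enum ((S :\: W) :\ y0).
pose E := enum ((W :\: S) :\ e1).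
pose s := B ++ D; pose L := e1 :: B ++ E.
have mem_s y : (y \in s) = (y \in S :\ y0).
  rewrite mem_cat !mem_enum !inE; case: (eqVneq y y0) => [->|] /=; first by rewrite (negPf y0W).
  by case: (y \in S); case: (y \in W).
have s_uniq : uniq s.
  rewrite cat_uniq !enum_uniq andbT; apply/hasPn=> y; rewrite !mem_enum !inE.
  by case: (y \in W); rewrite //= andbF.
have L_uniq : uniq L.
  rewrite /= cat_uniq !enum_uniq !andbT mem_cat !mem_enum !inE eqxx.
  have := e1WS; rewrite inE => /andP[/negPf-> _]; rewrite andbF.
  by apply/hasPn=> y; rewrite !mem_enum !inE; case: (y \in S); rewrite /= ?andbF.
have LW y : y \in L -> y \in W.
  rewrite inE mem_cat !mem_enum !inE => /or3P[/eqP->|/andP[]|/and3P[]] //.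
  by move: e1WS; rewrite inE => /andP[].
have sL : size s = size L.
  rewrite /= !size_cat -!cardE; have := cardsD1 e1 (W :\: S); rewrite e1WS.
  by have := cardsD1 y0 (S :\: W); rewrite cSW !inE y0W y0S /=; lia.
have L_in_S i : i < size L -> nth e1 L i \in S -> 0 < i /\ nth e1 L i = nth e1 s i.-1.
  case: i => [|i] iL /=; first by move: e1WS; rewrite inE => /andP[/negPf->].
  rewrite !nth_cat; case: ltnP => // Bi.
  have : nth e1 E (i - size B) \in E.
    by rewrite mem_nth //; move: iL; rewrite /= size_cat; lia.
  by rewrite mem_enum !inE => /and3P[_ /negPf->].
pose l y := nth e1 L (index y s).
have idx y : y \in S :\ y0 -> index y s < size L.
  by rewrite -mem_s -index_mem sL.
have l_in_S y : y \in S :\ y0 -> l y \in S -> l y \in S :\ y0 /\ index (l y) s < index y s.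
  move=> yS lS; have [i0 lE] := L_in_S _ (idx _ yS) lS.
  have is_ := idx _ yS; rewrite /l lE -mem_s mem_nth; last by rewrite sL; lia.
  by rewrite index_uniq // ?sL ?(leq_ltn_trans (leq_pred _) is_) // prednK.
exists y0, l; split=> //.
- move=> y yS; split; first by apply/LW/mem_nth/idx.
  apply: contraTneq (yS) => ly; apply/negP=> _.
  have [|_] := l_in_S y yS; last by rewrite ly ltnn.
  by rewrite ly; move: yS; rewrite inE => /andP[].
- move=> y y' yS y'S /eqP; rewrite nth_uniq ?idx // => /eqP ii.
  by rewrite -(nth_index e1 (_ : y \in s)) ?ii ?nth_index ?mem_s.
move=> y y' yS y'S yy'.
have ny0 z : z \in S :\ y0 -> y0 != l z.
  move=> zS; apply: contraTneq y0S => lz; apply/negP=> y0S'.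
  by have [|] := l_in_S z zS; rewrite -lz // !inE eqxx.
have [y0E | yy0] := eqVneq y y0.
  by left; rewrite y0E ny0 ?inE ?y'S ?andbT; move: yy'; rewrite y0E eq_sym.
have [y0E | y'y0] := eqVneq y' y0; first by right; rewrite y0E ny0 ?inE ?yy0.
have yT : y \in S :\ y0 by rewrite !inE yy0.
have y'T : y' \in S :\ y0 by rewrite !inE y'y0.
have [ly | ly] := eqVneq y' (l y); last by right.
left; split=> //; apply: contraTneq (y'S) => ly'; apply/negP=> _.
have [|_ lt1] := l_in_S y yT; first by rewrite -ly.
have [|_ lt2] := l_in_S y' y'T; first by rewrite -ly'.
by rewrite -ly in lt1; rewrite -ly' in lt2; have := ltn_trans lt1 lt2; rewrite ltnn.
Qed.

(** Here [S] is [W] plus the single vertex [y0], and [l] is a cyclic shift of [W]; a cycle of length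
    at least 3 has no fixed points and no 2-cycles. *)
Lemma linking_cyclic : #|S| = #|W|.+1 -> W \subset S -> 2 < #|W| -> f \notin S ->
  exists y0 l, is_linking y0 l.
Proof.
move=> cS WS W3 fS.
have [y0] : exists y0, y0 \in S :\: W.
  by apply/set0Pn; rewrite -card_gt0 cardsD (setIidPr WS) cS; lia.
rewrite inE => /andP[y0W y0S].
have SE : S :\ y0 = W.
  apply/eqP; rewrite eq_sym eqEcard subsetD1 WS y0W /=.
  by have := cardsD1 y0 S; rewrite y0S cS; lia.
pose s := enum W; pose nx i := if i.+1 == size s then 0 else i.+1.
have sW : size s = #|W| by rewrite -cardE.
have nxs i : i < size s -> nx i < size s by rewrite /nx; case: eqP; lia.
pose l y := nth y0 s (nx (index y s)).
have mem_s y : (y \in s) = (y \in W) by rewrite mem_enum.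
have idx y : y \in W -> index y s < size s by rewrite index_mem mem_s.
have lE y y' : y \in W -> y' \in W -> l y = y' -> nx (index y s) = index y' s.
  by move=> yW y'W <-; rewrite index_uniq ?enum_uniq // nxs // idx.
have idx_inj y y' : y \in W -> index y s = index y' s -> y = y'.
  move=> yW ii; rewrite -(nth_index y0 (_ : y \in s)) ?mem_s // ii nth_index //.
  by rewrite -index_mem -ii index_mem mem_s.
have lW y : y \in W -> l y \in W by move=> yW; rewrite -mem_s mem_nth // nxs // idx.
exists y0, l; rewrite /is_linking SE; split=> //.
- by apply: contraNneq fS => <-.
- move=> y yW; split; first exact: lW.
  by apply/eqP=> /lE -/(_ yW yW); rewrite /nx; have := idx y yW; case: eqP; lia.
- move=> y y' yW y'W ll; apply: idx_inj => //.
  have := lE y _ yW (lW y yW) erefl; have := lE y' _ y'W (lW y' y'W) erefl.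
  rewrite -ll => <-; have := idx y yW; have := idx y' y'W; rewrite /nx.
  by case: eqP; case: eqP; lia.
move=> y y' yS y'S yy'.
have inW z : z \in S -> z != y0 -> z \in W by move=> zS zy; rewrite -SE !inE zy.
have ny0 z : z \in W -> y0 != l z by move=> zW; apply: contraNneq y0W => ->; apply: lW.
have [y0E | yy0] := eqVneq y y0.
  by left; rewrite y0E ny0 ?inW //; move: yy'; rewrite y0E eq_sym.
have [y0E | y'y0] := eqVneq y' y0; first by right; rewrite y0E ny0 ?inW.
have {}yW := inW y yS yy0; have {}y'W := inW y' y'S y'y0.
have [ly | ly] := eqVneq y' (l y); last by right.
left; split=> //; apply/eqP=> ly'.
have := lE y y' yW y'W (esym ly); have := lE y' y y'W yW (esym ly').
have := idx y yW; have := idx y' y'W; rewrite /nx; move: sW W3; clear.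
by move: (index y s) (index y' s) (size s) => i j n; case: eqP; case: eqP; lia.
Qed.

Lemma linking_exists : #|S| = #|W|.+1 ->
  ~~ (W \subset S) || (2 < #|W|) && (f \notin S) -> exists y0 l, is_linking y0 l.
Proof.
move=> cS; have [WS /= /andP[W3 fS] | nWS _] := boolP (W \subset S).
  exact: linking_cyclic.
exact: linking_acyclic.
Qed.

End Linking.

(** * The graph on pairs *)

Section ModelOperations.
Variables (T : finType) (e : rel T).
Hypothesis e_sym : symmetric e.

Lemma kmodel_sum (I J : finType) (A : I -> {set T}) (B : J -> {set T}) :
    kmodel e A -> kmodel e B ->
    (forall i j x, x \in A i -> x \notin B j) ->
    (forall i j, exists x y, [/\ x \in A i, y \in B j & e x y]) ->
  kmodel e (fun k : I + J => match k with inl i => A i | inr j => B j end).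
Proof.
move=> [A0 Ac Ai Aa] [B0 Bc Bi Ba] dis cross; split.
- by case.
- by case.
- case=> i [] j x xi xj.
  + by rewrite (Ai _ _ _ xi xj).
  + by rewrite (negPf (dis _ _ _ xi)) in xj.
  + by rewrite (negPf (dis _ _ _ xj)) in xi.
  + by rewrite (Bi _ _ _ xi xj).
- case=> i [] j ij //; first exact: Aa; last exact: Ba.
  by have [x [y [xA yB xy]]] := cross j i; exists y, x; rewrite e_sym.
Qed.

Lemma kmodel_option (I : finType) (A : I -> {set T}) (E : {set T}) :
    kmodel e A -> E != set0 -> connected_in e E ->
    (forall i x, x \in A i -> x \notin E) ->
    (forall i, exists x y, [/\ x \in A i, y \in E & e x y]) ->
  kmodel e (fun k : option I => if k is Some i then A i else E).
Proof.
move=> [A0 Ac Ai Aa] E0 Ec dis cross; split.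
- by case.
- by case.
- case=> [i|] [j|] x xi xj //.
  + by rewrite (Ai _ _ _ xi xj).
  + by rewrite (negPf (dis _ _ xi)) in xj.
  + by rewrite (negPf (dis _ _ xj)) in xi.
- case=> [i|] [j|] ij //; first exact: Aa.
  by have [x [y [xA yB xy]]] := cross j; exists y, x; rewrite e_sym.
Qed.

(** With at least two branch sets every vertex of a branch set lies on an edge: its set is
    connected, and if it is a singleton it still touches another set. Hence all branch sets lie in
    [D], where [s] is injective. *)
Lemma has_kmodel_section (T' : finType) (e' : rel T') (D : pred T)
    (h : T' -> T) (s : T -> T') n :
    {in D, cancel s h} ->
    (forall x y, e x y -> [/\ x \in D, y \in D & e' (s x) (s y)]) ->
  1 < n -> has_kmodel e n -> has_kmodel e' n.
Proof.
move=> sK se n1 [I [B [In [B0 Bc Bi Ba]]]]; exists I, (fun i => s @: B i); split=> //.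
have BD i x : x \in B i -> x \in D.
  move=> xi.
  have [xB1 | [z [zi zx]]] : B i = [set x] \/ exists z, z \in B i /\ z != x.
    have [|/subsetPn[z zi]] := boolP (B i \subset [set x]).
      by rewrite subset1 (negPf (B0 i)) orbF => /eqP; left.
    by rewrite inE => zx; right; exists z.
    have [j ij] : exists j, i != j.
      have: 1 < #|I| by rewrite In.
      case/card_gt1P=> a [b [_ _ ab]].
      by have [ia | ] := eqVneq i a; [exists b; rewrite ia | exists a].
    have [a [b [ai _ ab]]] := Ba i j ij.
    by move: ai; rewrite xB1 inE => /eqP <-; have [] := se _ _ ab.
  have /connectP[[|a p] /= ] := Bc i x z xi zi; first by move=> _ zxE; rewrite zxE eqxx in zx.
  by case/andP=> /andP[_ xa] _ _; have [] := se _ _ xa.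
split.
- by move=> i; have /set0Pn[x xi] := B0 i; apply/set0Pn; exists (s x); apply: imset_f.
- move=> i _ _ /imsetP[x xi ->] /imsetP[y yi ->].
  apply: connect_map (Bc i x y xi yi) => a b /andP[/andP[ai bi] ab].
  by apply: connect1; rewrite /= !imset_f //=; have [] := se _ _ ab.
- move=> i j _ /imsetP[x xi ->] /imsetP[y yj /(congr1 h)].
  rewrite (sK _ (BD i _ xi)) (sK _ (BD j _ yj)) => xy; rewrite -xy in yj.
  exact: Bi xi yj.
- move=> i j /Ba[x [y [xi yj xy]]]; exists (s x), (s y).
  by rewrite !imset_f //; have [] := se _ _ xy.
Qed.

End ModelOperations.

Section HeadSets.
Variables (V : finType) (O : rel V).
Hypothesis O_irr : irreflexive O.

Definition adj u v := O u v || O v u.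

(** The 3-arc graph with parallel arcs merged. It lives on all pairs of vertices; those that are not
    arcs are isolated. *)
Definition arc_adj : rel (V * V) := fun p q =>
  [&& O p.1 p.2, O q.1 q.2, adj p.1 q.1, p.2 != q.1 & q.2 != p.1].

Lemma adj_sym : symmetric adj.
Proof. by move=> u v; rewrite /adj orbC. Qed.

Lemma adj_irr : irreflexive adj.
Proof. by move=> u; rewrite /adj O_irr. Qed.

Lemma arc_adj_sym : symmetric arc_adj.
Proof.
move=> p q; rewrite /arc_adj adj_sym; case: (O p.1 _); case: (O q.1 _) => //=.
by congr (_ && _); rewrite andbC.
Qed.

Lemma arc_adj_irr : irreflexive arc_adj.
Proof. by move=> p; rewrite /arc_adj adj_irr !andbF. Qed.

Lemma arc_adjE u y w s : O u y -> O w s ->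
  arc_adj (u, y) (w, s) = [&& adj u w, y != w & s != u].
Proof. by rewrite /arc_adj /= => -> ->. Qed.

(** Arcs of the same tail are never adjacent, but [(u, y)] touches [(w, h w)] whenever [y] is not
    [w]. So the branch set of [y] joins its hub arc to the arc of tail [l y]; the linking makes
    these sets connected and pairwise touching. *)
Lemma star_kmodel u (S W : {set V}) (f : V) (h : V -> V) :
    {in S, forall y, O u y} -> #|S| = #|W|.+1 ->
    ~~ (W \subset S) || (2 < #|W|) && (f \notin S) ->
    {in W, forall w, [/\ adj u w, O w (h w) & h w != u]} ->
  exists y0 (B : V -> {set V * V}),
    [/\ y0 != f, kmodel arc_adj (fun y : {y | y \in S} => B (val y)),
        {in S, forall y, (u, y) \in B y},
        {in S, forall y p, p \in B y -> p = (u, y) \/ exists2 w, w \in W & p = (w, h w)}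
      & {in S, forall y, y != y0 -> exists2 w, w \in W & (w, h w) \in B y}].
Proof.
move=> SO cS cond hW; have [y0 [l [y0S y0f lW l_inj lP]]] := linking_exists cS cond.
pose B y := if y == y0 then [set (u, y)] else [set (u, y); (l y, h (l y))].
have uB y : (u, y) \in B y by rewrite /B; case: ifP => _; rewrite !inE eqxx.
have l_ok y : y \in S -> y != y0 -> [/\ l y \in W, l y != y & l y != u].
  move=> yS yy0; have [|lyW ly] := lW y; first by rewrite !inE yy0.
  split=> //; have [uw _ _] := hW _ lyW.
  by apply: contraTneq uw => ->; rewrite adj_irr.
have lB y : y != y0 -> (l y, h (l y)) \in B y.
  by move=> yy0; rewrite /B (negPf yy0) !inE eqxx orbT.
have BP y p : y \in S -> p \in B y ->
    p = (u, y) \/ (y != y0 /\ p = (l y, h (l y))).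
  move=> yS; rewrite /B; case: eqVneq => [->|yy0]; rewrite !inE.
    by move/eqP; left.
  by case/orP=> /eqP; [left | right].
have touch y y' : y \in S -> y' \in S -> y' != y0 -> y != l y' ->
    arc_adj (u, y) (l y', h (l y')).
  move=> yS y'S y'y0 yl; have [lyW _ _] := l_ok _ y'S y'y0.
  by have [uw Ow hw] := hW _ lyW; rewrite arc_adjE ?SO // uw yl.
exists y0, B; split=> //.
- split=> [i|i|i j p|i j ij].
  + by apply/set0Pn; exists (u, val i).
  + rewrite /B; case: eqVneq => [_|yy0]; first exact: connected_in1.
    have [_ ly _] := l_ok _ (valP i) yy0.
    by apply: connected_in2; rewrite ?touch ?(valP i) // 1?eq_sym //; apply: arc_adj_sym.
  + move=> /(BP _ _ (valP i)) pi /(BP _ _ (valP j)) pj; apply: val_inj.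
    case: pi pj => [->|[iy0 ->]] [[]|[jy0 []]] //.
    * by have [_ _ /eqP lu] := l_ok _ (valP j) jy0 => /esym.
    * by have [_ _ /eqP lu] := l_ok _ (valP i) iy0.
    * by move=> ll _; apply: l_inj; rewrite // !inE ?iy0 ?jy0 (valP i, valP j).
  + have [|[jy0 il]|[iy0 jl]] := lP _ _ (valP i) (valP j); first by rewrite (inj_eq val_inj).
    * by exists (u, val i), (l (val j), h (l (val j))); split;
        [apply: uB | apply: lB | apply: touch; rewrite ?(valP i, valP j)].
    * exists (l (val i), h (l (val i))), (u, val j).
      by split; [apply: lB | apply: uB | rewrite arc_adj_sym touch ?(valP i, valP j)].
- by move=> y yS p /(BP _ _ yS)[|[yy0 ->]]; [left | right; exists (l y) => //; have [] := l_ok _ yS yy0].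
- by move=> y yS yy0; exists (l y); [have [] := l_ok _ yS yy0 | apply: lB].
Qed.

End HeadSets.

(** * Models built from one or two hubs *)

(** [W1] takes as many tails outside [S1] as it can; the part [B1] forced into [S1] is kept away
    from [W2], so a common tail is never in [S1]. Each set keeps a member outside its own heads, as
    [linking_acyclic] requires. *)
Lemma shared_links (V : finType) (S1 S2 M1 M2 : {set V}) :
    1 < #|S1| -> 1 < #|S2| ->
    #|S2| <= #|M1 :\: S1|.+1 -> #|S1| + #|S2| <= #|M1|.+2 ->
    #|S1| <= #|M2 :\: S2|.+1 -> #|S1| + #|S2| <= #|M2|.+3 ->
  exists W1 W2 : {set V},
    [/\ W1 \subset M1 /\ W2 \subset M2, #|S1| = #|W1|.+1 /\ #|S2| = #|W2|.+1,
        ~~ (W1 \subset S1), ~~ (W2 \subset S2)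
      & forall w, w \in W1 -> w \in W2 -> w \notin S1].
Proof.
move=> a2 b2 h1 h2 h3 h4.
set a := #|S1| in a2 h2 h3 h4 *; set b := #|S2| in b2 h1 h2 h4 *.
have [A1 sA1 cA1] : exists2 A1 : {set V}, A1 \subset M1 :\: S1 & #|A1| = minn a.-1 #|M1 :\: S1|.
  by apply: exists_subset_card; apply: geq_minr.
have [B1 sB1 cB1] : exists2 B1 : {set V}, B1 \subset M1 :&: S1 & #|B1| = a.-1 - #|A1|.
  by apply: exists_subset_card; have := cardsID S1 M1; lia.
have dAB : [disjoint A1 & B1].
  rewrite -setI_eq0; apply/eqP/setP=> w; rewrite !inE; apply/negP=> /andP[/(subsetP sA1) + /(subsetP sB1)].
  by rewrite !inE => /andP[/negPf-> _]; rewrite andbF.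
have cW1 : #|A1 :|: B1| = a.-1.
  by have := cardsUI A1 B1; rewrite (eqP (_ : A1 :&: B1 == set0)) ?setI_eq0 // cards0; lia.
have [e2] : exists e2, e2 \in (M2 :\: S2) :\: B1.
  apply/set0Pn; rewrite -card_gt0; have := cardsID B1 (M2 :\: S2).
  have := subset_leq_card (subsetIr (M2 :\: S2) B1); lia.
rewrite !inE => /and3P[e2B e2S e2M].
have [C sC cC] : exists2 C : {set V}, C \subset (M2 :\: B1) :\ e2 & #|C| = b.-2.
  apply: exists_subset_card; have := cardsD1 e2 (M2 :\: B1).
  rewrite !inE e2B e2M; have := cardsID B1 M2.
  have := subset_leq_card (subsetIr M2 B1); lia.
have e2C : e2 \notin C by apply/negP=> /(subsetP sC); rewrite !inE eqxx.
exists (A1 :|: B1), (e2 |: C); split.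
- split; apply/subsetP=> w; rewrite !inE.
    by case/orP=> [/(subsetP sA1) | /(subsetP sB1)]; rewrite !inE => /andP[].
  by case/predU1P=> [-> // | /(subsetP sC)]; rewrite !inE => /and3P[].
- by rewrite cW1 cardsU1 e2C cC; lia.
- have /card_gt0P[w wA] : 0 < #|A1| by lia.
  apply/subsetPn; exists w; first by rewrite !inE wA.
  by move/(subsetP sA1): wA; rewrite !inE => /andP[].
- by apply/subsetPn; exists e2; rewrite // !inE eqxx.
move=> w; rewrite !inE => /orP[/(subsetP sA1) | wB]; first by rewrite !inE => /andP[].
case/predU1P=> [wE | /(subsetP sC)]; first by rewrite -wE wB in e2B.
by rewrite !inE wB /= andbF.
Qed.

Section Hubs.
Variables (V : finType) (O : rel V).
Hypothesis O_irr : irreflexive O.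
Local Notation adj := (adj O).
Local Notation arc_adj := (arc_adj O).

Definition out u : {set V} := [set y | O u y].
Definition has_out_but u x := [exists y, O u y && (y != x)].

Definition core_adj u v := [&& adj u v, has_out_but u v & has_out_but v u].
Definition core_nbrs u : {set V} := [set w | core_adj u w].

Lemma core_adj_sym : symmetric core_adj.
Proof. by move=> u v; rewrite /core_adj adj_sym; congr (_ && _); rewrite andbC. Qed.

Lemma core_adj_irr : irreflexive core_adj.
Proof. by move=> u; rewrite /core_adj adj_irr. Qed.

Lemma core_adj_adj u v : core_adj u v -> adj u v.
Proof. by case/and3P. Qed.

Definition link_head w x := odflt w [pick s | O w s && (s != x)].

Lemma link_headP w x : has_out_but w x -> O w (link_head w x) /\ link_head w x != x.
Proof.
move=> /existsP[s ws]; rewrite /link_head; case: pickP => [y /andP[] //|/(_ s)].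
by rewrite ws.
Qed.

(** As [u] and [x] are adjacent, all arcs [(u, y)] and [(x, z)] with [y] other than [x] and [z]
    other than [u] are adjacent, so the stars at the two hubs join into one model. [M1] and [M2] are
    the tails that may be spent, which allows a further branch set to be kept disjoint. *)
Lemma two_hub_kmodel u x (S2 M1 M2 : {set V}) (f : V) :
    O u x -> S2 \subset out x :\ u ->
    M1 \subset core_nbrs u :\ x -> M2 \subset core_nbrs x :\ u ->
    1 < #|out u :\ x| -> 1 < #|S2| ->
    #|S2| <= #|M1 :\: (out u :\ x)|.+1 -> #|out u :\ x| + #|S2| <= #|M1|.+2 ->
    #|out u :\ x| <= #|M2 :\: S2|.+1 -> #|out u :\ x| + #|S2| <= #|M2|.+3 ->
  exists y0 (B1 B2 : V -> {set V * V}),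
    [/\ y0 != f,
        kmodel arc_adj (fun k : {y | y \in out u :\ x} + {z | z \in S2} =>
          match k with inl y => B1 (val y) | inr z => B2 (val z) end),
        {in out u :\ x, forall y, [/\ (u, y) \in B1 y,
           forall p, p \in B1 y -> p = (u, y) \/ [/\ p.1 \in M1, O p.1 p.2 & p.2 != u]
         & y != y0 -> exists2 p, p \in B1 y & [/\ p.1 \in M1, O p.1 p.2 & p.2 != u]]}
      & {in S2, forall z, (x, z) \in B2 z /\
           forall p, p \in B2 z -> p = (x, z) \/ [/\ p.1 \in M2, O p.1 p.2 & p.2 != x]}].
Proof.
move=> ux S2x M1u M2x a2 b2 h1 h2 h3 h4.
have [W1 [W2 [[W1M W2M] [cW1 cW2] nW1 nW2 W12]]] := shared_links a2 b2 h1 h2 h3 h4.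
have u_x : u != x by apply: contraTneq ux => ->; rewrite O_irr.
have W1P w : w \in W1 -> [/\ adj u w, has_out_but w u & w != x].
  by move=> /(subsetP W1M)/(subsetP M1u); rewrite !inE => /andP[-> /and3P[-> _ ->]].
have W2P w : w \in W2 -> [/\ adj x w, has_out_but w x & w != u].
  by move=> /(subsetP W2M)/(subsetP M2x); rewrite !inE => /andP[-> /and3P[-> _ ->]].
(* A tail used for both hubs is not a head of [u], so it sends an arc to [u],
   which serves the hub [x] while another arc of the same tail serves [u]. *)
pose h1' w := link_head w u.
pose h2' w := if w \in W1 then u else link_head w x.
have h1P w : w \in W1 -> [/\ adj u w, O w (h1' w) & h1' w != u].
  by case/W1P=> uw /link_headP[]; split.
have h2P w : w \in W2 -> [/\ adj x w, O w (h2' w) & h2' w != x].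
  move=> wW2; have [xw /link_headP[Ow wx] wu] := W2P w wW2; rewrite /h2'.
  case: ifP => // wW1; have [+ _ w_x] := W1P w wW1.
  by have := W12 w wW1 wW2; rewrite !inE w_x /= /Submission.adj => /negPf->.
have [||y0 [B1 [y0f km1 uB1 B1P B1l]]] :=
    star_kmodel O_irr (u := u) (f := f) (h := h1') _ cW1 _ h1P.
- by move=> y; rewrite !inE => /andP[].
- by rewrite nW1.
have [||y1 [B2 [_ km2 xB2 B2P _]]] :=
    star_kmodel O_irr (u := x) (f := f) (h := h2') _ cW2 _ h2P.
- by move=> z /(subsetP S2x); rewrite !inE => /andP[].
- by rewrite nW2.
exists y0, B1, B2; split=> //.
- apply: kmodel_sum => //; first exact: arc_adj_sym.
    move=> i j p /(B1P _ (valP i)) pi; apply/negP=> /(B2P _ (valP j)) pj.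
    case: pi pj => [->|[w wW1 ->]] [[]|[w' w'W2 []]].
    + by move=> uxE; rewrite uxE eqxx in u_x.
    + by move=> uw' _; have [_ _] := W2P w' w'W2; rewrite uw' eqxx.
    + by move=> wx _; have [_ _] := W1P w wW1; rewrite wx eqxx.
    + move=> ww'; rewrite -{w'}ww' in w'W2 *; rewrite /h2' wW1.
      by have [_ _ /eqP] := h1P w wW1.
  move=> i j; exists (u, val i), (x, val j); split; [exact: uB1 (valP i) | exact: xB2 (valP j)|].
  have := subsetP S2x _ (valP j); have := valP i; rewrite !inE => /andP[ix ui] /andP[ju xj].
  by rewrite arc_adjE // ix ju /Submission.adj ux.
- move=> y yS; split; first exact: uB1.
    move=> p /(B1P y yS)[|[w wW1 ->]]; [by left | right].
    by have [_ Ow wu] := h1P w wW1; rewrite (subsetP W1M).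
  move=> yy0; have [w wW1 wB] := B1l y yS yy0; exists (w, h1' w) => //.
  by have [_ Ow wu] := h1P w wW1; rewrite (subsetP W1M).
- move=> z zS; split; first exact: xB2.
  move=> p /(B2P z zS)[|[w wW2 ->]]; [by left | right].
  by have [_ Ow wx] := h2P w wW2; rewrite (subsetP W2M).
Qed.

End Hubs.

Section Slack.
Variables (V : finType) (O : rel V) (k : nat).
Hypothesis O_irr : irreflexive O.
Local Notation adj := (adj O).
Local Notation arc_adj := (arc_adj O).
Local Notation core_adj := (core_adj O).
Local Notation N := (core_nbrs O).
Local Notation out := (out O).

(** One unit to spare over [k] core neighbours, supplied either by a further core neighbour or by a
    head that does not use one up. *)
Definition slack u := k <= #|N u| /\ (k < #|N u| \/ exists2 y, y \in out u & y \notin N u).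

(** If the slack is a head [y] that is not a core neighbour, [y] is put into [S], which then uses up
    at most [n - 1] core neighbours. *)
Lemma slack_card u (X : {set V}) n : slack u -> X \subset out u ->
    (forall y, y \in out u -> y \notin N u -> y \in X) -> 0 < n <= #|X| ->
  exists S : {set V}, [/\ S \subset X, #|S| = n & k < #|N u :\: S| + n].
Proof.
move=> [kN [ltkN | [y yO yN]]] XO Xy /andP[n0 nX].
  have [S SX cS] := exists_subset_card nX; exists S; split=> //.
  by have := cardsID S (N u); have := subset_leq_card (subsetIr (N u) S); lia.
have yX := Xy y yO yN.
have [S SX cS] : exists2 S : {set V}, S \subset X :\ y & #|S| = n.-1.
  by apply: exists_subset_card; have := cardsD1 y X; rewrite yX; lia.
have yS : y \notin S by apply/negP=> /(subsetP SX); rewrite !inE eqxx.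
exists (y |: S); split.
- apply/subsetP=> z; case/setU1P=> [-> // | /(subsetP SX)].
  by rewrite !inE => /andP[].
- by rewrite cardsU1 yS cS; lia.
have := cardsID (y |: S) (N u); suff: #|N u :&: (y |: S)| <= n.-1 by lia.
rewrite -cS; apply: subset_leq_card; apply/subsetP=> z; rewrite in_setI in_setU1.
by case: eqVneq => [->|_ /andP[]//]; rewrite (negPf yN).
Qed.

Lemma slack_card_but u x (X := out u :\ x) n : slack u -> core_adj u x -> 0 < n <= #|X| ->
  exists S : {set V}, [/\ S \subset X, #|S| = n & n + #|(N u :\ x) :\: S| >= k].
Proof.
move=> su ux nX; have [||S [SX cS kS]] := slack_card (X := X) su _ _ nX.
- by apply: subsetDl.
- move=> y yO yN; rewrite in_setD1 yO andbT.
  by apply: contraNneq yN => ->; rewrite inE.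
exists S; split=> //; rewrite setDDl setUC -setDDl.
by have := cardsD1 x (N u :\: S); rewrite leq_eqVlt; lia.
Qed.

Lemma slack_card_out u x : slack u -> core_adj u x -> 0 < #|out u :\ x| ->
  #|out u :\ x| + #|(N u :\ x) :\: (out u :\ x)| >= k.
Proof.
move=> su ux n0; have [|S [SX cS kS]] := slack_card_but su ux (n := #|out u :\ x|).
  by rewrite n0 leqnn.
by have /eqP SE : S == out u :\ x; [rewrite eqEcard SX cS leqnn | rewrite -SE {1}SE].
Qed.

(** The star at [u] with [k] heads gives [k] branch sets. The slack leaves a core neighbour [f] that
    is neither a head in [S] nor a tail in [W]; a single arc from [f] touches every hub arc and is
    the last branch set. *)
Lemma star_hub_kmodel u : 3 < k -> slack u -> k <= #|out u| -> has_kmodel arc_adj k.+1.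
Proof.
move=> k4 su kO; have [||| S [SO cS kS]] := slack_card (X := out u) (n := k) su; rewrite ?kO //; try lia.
have [f] : exists f, f \in N u :\: S by apply/set0Pn; rewrite -card_gt0; lia.
rewrite in_setD => /andP[fS fN].
have [W sW cW] : exists2 W : {set V}, W \subset N u :\ f & #|W| = k.-1.
  by apply: exists_subset_card; have := cardsD1 f (N u); rewrite fN; case: su; lia.
have NP w : w \in N u -> [/\ adj u w, O w (link_head O w u) & link_head O w u != u].
  by rewrite inE => /and3P[uw _ /link_headP[]]; split.
have [|||| y0 [B [_ km uB BP _]]] := @star_kmodel V O O_irr u S W f (fun w => link_head O w u).
- by move=> y /(subsetP SO); rewrite inE.
- by rewrite cS cW; lia.
- by rewrite fS cW; apply/orP; right; lia.
- by move=> w /(subsetP sW) /setD1P[_ /NP].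
have [uf Of fu] := NP f fN.
have f_u : f != u by apply: contraTneq uf => ->; rewrite adj_irr.
have fE : forall i : {y | y \in S}, (f, link_head O f u) \notin B (val i).
  move=> i; apply/negP=> /(BP _ (valP i))[[fuE _]|[w /(subsetP sW)/setD1P[wf _] [fw _]]].
    by rewrite fuE eqxx in f_u.
  by rewrite fw eqxx in wf.
exists _, (fun j : option {y | y \in S} => if j is Some i then B (val i) else [set (f, link_head O f u)]).
split; first by rewrite card_option card_sig (eq_card (_ : _ =i S)) ?cS // => y; rewrite inE.
apply: kmodel_option => //.
- exact: arc_adj_sym.
- by apply/set0Pn; exists (f, link_head O f u); rewrite inE.
- exact: connected_in1.
- by move=> i p pi; apply: contraTN pi => /set1P->.
move=> i; exists (u, val i), (f, link_head O f u); split; [exact: uB (valP i) | by rewrite inE|].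
rewrite arc_adjE //; last by have := subsetP SO _ (valP i); rewrite inE.
by rewrite uf fu andbT; apply: contraNneq fS => <-; apply: valP.
Qed.

Lemma card_sum_sig (A B : {set V}) : #|{: {y | y \in A} + {z | z \in B}}| = #|A| + #|B|.
Proof.
by rewrite card_sum !card_sig; congr (_ + _); apply: eq_card => y; rewrite inE.
Qed.

Lemma double_hub_kmodel u x b : core_adj u x -> O u x -> slack u -> slack x ->
    1 < #|out u :\ x| -> 1 < b <= #|out x :\ u| -> #|out u :\ x| + b = k.+1 ->
  has_kmodel arc_adj k.+1.
Proof.
move=> cux ux su sx a2 /andP[b2 bx] ab.
have cxu : core_adj x u by rewrite core_adj_sym.
have [|S2 [S2x cS2 kS2]] := slack_card_but sx cxu (n := b); first by rewrite bx ltnW.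
have kS1 := slack_card_out su cux (ltnW a2).
have cN v w : slack v -> core_adj v w -> k <= #|N v :\ w|.+1.
  move=> [kN _] vw; have := cardsD1 w (N v); rewrite [w \in _]inE vw.
  by lia.
have := cN _ _ su cux; have := cN _ _ sx cxu => k2 k1.
have [| | | | | | y0 [B1 [B2 [_ km _ _]]]] :=
  @two_hub_kmodel V O O_irr u x S2 (N u :\ x) (N x :\ u) u ux S2x (subxx _) (subxx _); rewrite ?cS2 //; try lia.
by do 2!eexists; split; last exact: km; rewrite card_sum_sig cS2.
Qed.

End Slack.

(** * Core arcs of out-degree sum [k] *)

Lemma align_colours k (a b a' b' : 'I_k) : a != b -> a' != b' ->
  exists s : 'I_k -> 'I_k, [/\ injective s, s a = a' & s b = b'].
Proof.
move=> ab ab'; exists (tperm (tperm a a' b) b' \o tperm a a'); split.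
- by apply: inj_comp; apply: perm_inj.
- rewrite /= tpermL tpermD // 1?eq_sym //.
  by rewrite -{1}(tpermL a a') (inj_eq perm_inj).
- by rewrite /= tpermL.
Qed.

(** If [u] and [x] separated the rest, both sides could be coloured together with [u] and [x] by
    criticality. The ends of the edge get distinct colours on each side, so a permutation of the
    colours makes the two colourings agree there. *)
Lemma no_edge_cutset (T : finType) (e : rel T) k (H : {set T}) u x :
    symmetric e -> crit e k H -> u \in H -> x \in H -> e u x ->
  connected_in e (H :\ u :\ x).
Proof.
move=> e_sym Hcrit uH xH ux a b; set W := H :\ u :\ x => aW bW.
apply: contraT => nab; set r := [rel _ _ | _] in nab.
pose A := [set z in W | connect r a z].
have AW : A \subset W by apply/subsetP=> z; rewrite inE => /andP[].
have WP z : (z \in W) = [&& z != x, z != u & z \in H] by rewrite !inE.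
have aA : a \in A by rewrite inE aW connect0.
have bA : b \notin A by rewrite inE (negPf nab) andbF.
have uA : u \notin A by apply/negP=> /(subsetP AW); rewrite WP eqxx andbF.
have xA : x \notin A by apply/negP=> /(subsetP AW); rewrite WP eqxx.
have AH : A \subset H by apply/subsetP=> z /(subsetP AW); rewrite WP => /and3P[].
have [bx bu bH] : [/\ b != x, b != u & b \in H] by apply/and3P; rewrite -WP.
have [|c1 c1P] := crit_proper (S := H :\: A) Hcrit.
  apply/properP; split; first exact: subsetDl.
  by exists a; rewrite ?(subsetP AH) // inE aA.
have [|c2 c2P] := crit_proper (S := A :|: [set u; x]) Hcrit.
  apply/properP; split.
    by rewrite subUset AH; apply/subsetP=> z /set2P[]->.
  by exists b; rewrite // in_setU (negPf bA) /= in_set2 negb_or bu bx.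
have [|| s [s_inj su sx]] := @align_colours k (c2 u) (c2 x) (c1 u) (c1 x).
- by apply: c2P; rewrite // !inE eqxx ?orbT.
- by apply: c1P; rewrite // in_setD ?uA ?xA.
have [/negP[]] := Hcrit; apply/kcolP.
exists (fun z => if z \in A then s (c2 z) else c1 z).
have cross z w : z \in A -> w \notin A -> w \in H -> e z w -> s (c2 z) != c1 w.
  move=> zA wA wH zw.
  have wux : w \in [set u; x].
    apply: contraNT wA; rewrite !inE negb_or => /andP[wu wx].
    rewrite wH wu wx /=; move: (zA); rewrite inE => /andP[zW az].
    apply: connect_trans az _; apply: connect1.
    by rewrite /= zW WP wx wu wH.
  have -> : c1 w = s (c2 w) by case/set2P: wux => ->.
  by rewrite (inj_eq s_inj); apply: c2P; rewrite // in_setU ?zA // wux orbT.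
move=> z w zH wH zw; case: ifP => zA; case: ifP => wA.
- by rewrite (inj_eq s_inj); apply: c2P; rewrite // in_setU ?zA ?wA.
- by apply: cross; rewrite ?wA.
- by rewrite eq_sym; apply: cross; rewrite ?zA // e_sym.
- by apply: c1P; rewrite // inE ?zA ?wA.
Qed.

Lemma connected_path (T : finType) (e : rel T) s :
  symmetric e -> sorted e s -> connected_in e [set x in s].
Proof.
case: s => [|x0 s] e_sym s_path; first by move=> x y; rewrite inE.
have -> : [set x in x0 :: s] = interval x0 (x0 :: s) 0 (size (x0 :: s)).
  apply/setP=> x; rewrite inE; apply/idP/intervalP => [xs|[l [ls _ ->]]]; last exact: mem_nth.
  by exists (index x (x0 :: s)); rewrite index_mem xs nth_index.
exact: connected_interval.
Qed.

Section Bridge.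
Variables (V : finType) (O : rel V) (k : nat) (H : {set V}) (u x : V).
Hypothesis O_irr : irreflexive O.
Local Notation adj := (adj O).
Local Notation arc_adj := (arc_adj O).
Local Notation core_adj := (core_adj O).
Local Notation N := (core_nbrs O).
Local Notation out := (out O).
Hypotheses (k4 : 3 < k) (Hcrit : crit core_adj k H) (uH : u \in H) (xH : x \in H).
Hypotheses (cux : core_adj u x) (ux : O u x).

(** The pairs allowed in an additional branch set: the arc [(u, x)] is not a hub arc of the two-hub
    model, and all other arcs of tail [u] or [x] are excluded. *)
Let Z : {set V * V} := [set p | (p == (u, x)) || (p.1 != u) && (p.1 != x)].
Let r : rel (V * V) := [rel p q in Z | arc_adj p q].

Let u_x : u != x.
Proof. by apply: contraTneq ux => ->; rewrite O_irr. Qed.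

Let r_sym : connect_sym r.
Proof.
apply: sym_connect_sym => p q; rewrite /r /= arc_adj_sym //.
by congr (_ && _); rewrite andbC.
Qed.

Let degH v : v \in H -> k <= #|nbr core_adj H v|.
Proof. by apply: crit_deg => //; [apply: core_adj_sym | apply: core_adj_irr]. Qed.

Let ux_adj w s : core_adj u w -> w != x -> O w s -> s != u -> r (u, x) (w, s).
Proof.
move=> uw wx Ow su; have wu : w != u by apply: contraTneq uw => ->; rewrite core_adj_irr.
rewrite /r /= !inE eqxx /= wu wx orbT arc_adjE //.
by rewrite (core_adj_adj uw) su eq_sym wx.
Qed.

(** An arc from a core neighbour of [v] other than [u], [x], [y], [y'] touches both arcs. If there
    is none, the degree bound leaves exactly these four neighbours, all distinct, and then both arcs
    touch [(u, x)]. *)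
Lemma same_tail_connected v y y' : v \in H :\ u :\ x -> O v y -> O v y' ->
  connect r (v, y) (v, y').
Proof.
rewrite !inE => /and3P[vx vu vH] Oy Oy'.
have vZ t : (v, t) \in Z by rewrite inE vu vx orbT.
have [z /andP[zN zP] | noz] := pickP [pred z in nbr core_adj H v | [&& z != u, z != x, z != y & z != y']].
  have /and4P[zu zx zy zy'] := zP; move: zN; rewrite inE => /andP[zH vz].
  have [Oz zv] := link_headP (proj2 (andP (proj2 (andP vz)))).
  have zZ t : (z, t) \in Z by rewrite inE zu zx orbT.
  have step t : O v t -> z != t -> connect r (v, t) (z, link_head O z v).
    move=> Ot zt; apply: connect1; rewrite /r /= vZ zZ arc_adjE //.
    by rewrite (core_adj_adj vz) zv eq_sym zt.
  by apply: connect_trans (step y Oy zy) _; rewrite r_sym; apply: step.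
have sub : nbr core_adj H v \subset [set u; x; y; y'].
  apply/subsetP=> z zN; have := noz z; rewrite !inE /= => /negbT.
  by move: zN; rewrite inE => ->; rewrite /= -!negb_or negbK -!orbA.
have c3 t : #|[set u; x; t]| <= 3.
  by apply: leq_trans (leq_card_setU _ _) _; rewrite cards1 cards2; case: (_ != _).
have c4 t t' : #|[set u; x; t; t']| <= 4.
  by apply: leq_trans (leq_card_setU _ _) _; rewrite cards1 addn1 ltnS c3.
have le4 : #|[set u; x; y; y']| <= #|nbr core_adj H v|.
  by apply: leq_trans (c4 _ _) (leq_trans k4 (degH vH)).
have NE : nbr core_adj H v = [set u; x; y; y'] by apply/eqP; rewrite eqEcard sub le4.
have card4 : 3 < #|[set u; x; y; y']| by rewrite -NE; apply: leq_trans (degH vH).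
have uv : core_adj u v.
  have : u \in nbr core_adj H v by rewrite NE !inE eqxx.
  by rewrite inE core_adj_sym => /andP[].
have y_u t t' : [set u; x; t; t'] = [set u; x; y; y'] -> t != u.
  move=> tE; apply: contraTneq card4 => tu; rewrite -tE tu -leqNgt.
  rewrite (_ : [set u; x; u; t'] = [set u; x; t']) ?c3 //.
  by apply/setP=> w; rewrite !inE; case: (w == u); rewrite ?orbT ?orbF.
rewrite r_sym; apply: connect_trans (_ : connect r (v, y') (u, x)) _.
  rewrite r_sym; apply/connect1/ux_adj => //; apply: (y_u y' y).
  by apply/setP=> w; rewrite !inE -!orbA [(w == y') || _]orbC.
by apply/connect1/ux_adj => //; apply: (y_u y y').
Qed.

(** A walk of tails in [H] without [u] and [x], which is connected by [no_edge_cutset], lifts to a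
    walk of arcs: at each tail [same_tail_connected] switches to an arc that avoids the next
    tail. *)
Lemma reach_arc v y : v \in H :\ u :\ x -> O v y -> connect r (u, x) (v, y).
Proof.
move=> vW Oy; have /subsetPn[w] : ~~ (nbr core_adj H u \subset [set x]).
  by apply/negP=> /subset_leq_card; rewrite cards1; have := degH uH; lia.
rewrite !inE => /andP[wH uw] wx.
have wu : w != u by apply: contraTneq uw => ->; rewrite core_adj_irr.
have wW : w \in H :\ u :\ x by rewrite !inE wx wu.
have [Ow hw] := link_headP (proj2 (andP (proj2 (andP uw)))).
have start t : O w t -> connect r (u, x) (w, t).
  move=> Ot; apply: connect_trans (connect1 (ux_adj uw wx Ow hw)) _.
  exact: same_tail_connected.
have /connectP[p] := no_edge_cutset (@core_adj_sym V O) Hcrit uH xH cux wW vW.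
elim: p w {uw wx wu Ow hw} wW wH start => [|z p IHp] w wW wH start /=.
  by move=> _ vE; rewrite vE in Oy *; apply: start.
case/andP=> /andP[/andP[_ zW] wz] zp vE; apply: (IHp z) => //.
  by move: zW; rewrite !inE => /and3P[].
move=> t Ot.
have [Ow hw] := link_headP (proj1 (andP (proj2 (andP wz)))).
have [Oz hz] := link_headP (proj2 (andP (proj2 (andP wz)))).
have inZ a s : a \in H :\ u :\ x -> (a, s) \in Z.
  by rewrite !inE => /and3P[-> -> _]; rewrite orbT.
apply: connect_trans (start _ Ow) (connect_trans _ (same_tail_connected zW Oz Ot)).
by apply: connect1; rewrite /r /= !inZ //= arc_adjE // (core_adj_adj wz) hw hz.
Qed.

(** The tail of such an arc is adjacent to [x] but is not a head of [x], so the arc touches every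
    arc of tail [x]. *)
Let far p := [&& O p.1 p.2, core_adj x p.1, ~~ O x p.1, p.2 != x & p.1 != u].

Let far_exists : #|out x :\ u|.+1 < k -> exists p, far p /\ connect r (u, x) p.
Proof.
move=> ltbk; have /subsetPn[w] : ~~ (nbr core_adj H x \subset u |: (out x :\ u)).
  apply/negP=> /subset_leq_card; rewrite cardsU1 !inE eqxx /=.
  by have := degH xH; lia.
rewrite !inE negb_or negb_and negbK => /andP[wH xw] /andP[wu].
rewrite (negPf wu) /= => nxw; have wx : w != x by apply: contraTneq xw => ->; rewrite core_adj_irr.
have [Ow hw] := link_headP (proj2 (andP (proj2 (andP xw)))).
exists (w, link_head O w x); rewrite /far /= Ow xw nxw hw wu; split=> //.
by apply: reach_arc; rewrite // !inE wx wu.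
Qed.

(** [E] is an initial piece of a shortest path from [(u, x)] to a [far] arc. Being connected and
    touching the hub arcs of [x], it can be a branch set, and it occupies few useful tails: [f]
    alone near [u], and at most [d1] and [d2] near [x]. *)
Lemma bridge : 0 < #|out x :\ u| -> #|out x :\ u|.+1 < k ->
  exists E f d1 d2,
    [/\ connected_in arc_adj E /\ (u, x) \in E,
        (exists2 p, p \in E & p.1 = f /\ arc_adj (u, x) p) /\
        (forall p, p \in E -> arc_adj (u, x) p -> p.1 = f),
        d1 \in out x /\ (forall p, p \in E -> O p.1 p.2 -> adj x p.1 -> p.2 != x -> p.1 != u ->
           p.1 \in [set d1; d2]),
        forall p, p \in E -> p = (u, x) \/ (p.1 != u /\ p.1 != x)
      & {in out x :\ u, forall z, exists2 p, p \in E & arc_adj (x, z) p}].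
Proof.
move=> b0 ltbk.
have [|n [s [s_path slast sn]] mins] :=
  @min_natP (fun n => exists s, [/\ path r (u, x) s, far (last (u, x) s) & size s = n]).
  have [p [pfar /connectP[s s_path pE]]] := far_exists ltbk.
  by exists (size s), s; rewrite -pE.
(* An arc of the path adjacent to the start must come first, or the path could be shortened. *)
have shortcut s1 p s2 : s = s1 ++ p :: s2 -> arc_adj (u, x) p -> s1 = [::].
  move=> sE uxp; have := s_path; rewrite sE cat_path /= => /and3P[_ lp ps2].
  case: s1 sE lp => // a s1 sE /andP[/andP[_ pZ] _].
  have := mins (size (p :: s2)); rewrite -sn sE size_cat => le_s.
  suff /le_s : exists s0, [/\ path r (u, x) s0, far (last (u, x) s0) & size s0 = size (p :: s2)].
    by rewrite /=; clear; lia.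
  exists (p :: s2); split=> //; last by move: slast; rewrite sE last_cat.
  by rewrite /= ps2 /r /= pZ uxp inE eqxx.
pose good m := [forall z in out x :\ u, has (arc_adj (x, z)) (take m s)].
have good_all : good (size s).
  apply/forall_inP=> z; rewrite !inE take_size => /andP[zu xz].
  have /and5P[Op xp nxp px pu] := slast.
  apply/hasP; exists (last (u, x) s).
    by case: (s) pu => [|a s'] /=; rewrite ?eqxx // mem_last.
  case: (last _ _) Op xp nxp px {pu slast} => w t /= Ow xw nxw tx.
  rewrite arc_adjE // (core_adj_adj xw) tx andbT.
  by apply: contraNneq nxw => <-.
(* The path is stopped as soon as it touches all arcs from [x] to heads other than [u]. By
   minimality the arcs before the last miss some [(x, d1)]; among them, a tail available to [x] must
   therefore be [d1]. *)
have [m gm minm] := ex_minnP (ex_intro good _ good_all).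
have ms : m <= size s by apply: minm.
have [z0 z0S] : exists z, z \in out x :\ u by apply/set0Pn; rewrite -card_gt0.
case: m gm minm ms => [|m] gm minm ms; first by have /forall_inP/(_ z0 z0S) := gm; rewrite take0.
have : ~~ good m by apply/negP=> /minm; rewrite ltnn.
case/forall_inPn=> d1; rewrite in_setD1 => /andP[d1u d1x] nd1.
move/forall_inP: gm => gm {minm good_all}.
case: s s_path {slast sn mins good} shortcut gm ms nd1 => // p0 s s_path shortcut gm ms nd1.
have takeE : take m.+1 (p0 :: s) = rcons (take m (p0 :: s)) (nth p0 (p0 :: s) m) by rewrite -take_nth.
set t := take m.+1 (p0 :: s) in takeE.
have tE : t = p0 :: take m s by [].
have t_path : path r (u, x) t by move: s_path; rewrite -{1}(cat_take_drop m.+1 (p0 :: s)) cat_path => /andP[].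
have tZ : all (mem Z) t.
  by elim: (t) (u, x) t_path => //= p t' IHt q /andP[/andP[/andP[_ ->] _] /IHt].
have tS : {subset t <= p0 :: s} by move=> p; apply: mem_take.
have f_only p : p \in t -> arc_adj (u, x) p -> p = p0.
  move=> /tS ps uxp; have sE : p0 :: s = take (index p (p0 :: s)) (p0 :: s) ++ p :: drop (index p (p0 :: s)).+1 (p0 :: s).
    by rewrite -(drop_index ps) cat_take_drop.
  by have /(congr1 size) := shortcut _ _ _ sE uxp; rewrite /=; case: eqP.
have uxp0 : arc_adj (u, x) p0 by move: t_path; rewrite tE /= => /andP[/andP[]].
exists [set p in (u, x) :: t], p0.1, d1, (nth p0 (p0 :: s) m).1; split.
- rewrite !inE eqxx; split=> //; apply: connected_path; first exact: arc_adj_sym.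
  by apply: sub_path t_path => p q /andP[].
- split; first by exists p0; rewrite // inE in_cons tE mem_head orbT.
  move=> p; rewrite inE in_cons => /predU1P[-> | pt uxp]; first by rewrite arc_adj_irr.
  by rewrite (f_only p pt uxp).
- split=> // p; rewrite inE in_cons => /predU1P[-> _ _ _ | ]; first by rewrite eqxx.
  rewrite takeE mem_rcons inE => /predU1P[-> _ _ _ _|pm Op xp px pu]; first by rewrite set22.
  apply: contraNT nd1; rewrite !inE negb_or => /andP[pd1 _].
  apply/hasP; exists p; rewrite // /Submission.arc_adj /= Op xp px andbT eq_sym pd1 !andbT.
  by move: d1x; rewrite inE.
- move=> p; rewrite inE in_cons => /predU1P[->|/(allP tZ)/=]; first by left.
  by rewrite !inE => /orP[/eqP->|/andP[]]; [left | right].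
- move=> z zS; have /hasP[p pt xzp] := gm z zS.
  by exists p; rewrite // inE in_cons pt orbT.
Qed.

(** The hub arcs give only [k] branch sets; [E] is the missing one, and the tails it may share with
    the others are withheld from [M1] and [M2]. The counts bear this loss because the two numbers of
    heads add up to [k] and not to [k + 1]. *)
Lemma bridge_kmodel : slack O k u -> slack O k x ->
    1 < #|out u :\ x| -> 1 < #|out x :\ u| -> #|out u :\ x| + #|out x :\ u| = k ->
  has_kmodel arc_adj k.+1.
Proof.
move=> su sx a2 b2 ab; have cxu : core_adj x u by rewrite core_adj_sym.
have [||E [f [d1 [d2 [[E_conn uxE] [[pf pfE [pf1 uxpf]] f_only] [d1x d_only] EZ Etouch]]]]] := bridge.
- exact: ltnW.
- by move: a2; rewrite -ab; clear; lia.
have kS1 := slack_card_out su cux (ltnW a2).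
have kS2 := slack_card_out sx cxu (ltnW b2).
have [kNu _] := su; have [kNx _] := sx.
pose M1 := (N u :\ x) :\ f; pose M2 := (N x :\ u) :\: [set d1; d2].
have cD w (A : {set V}) : #|A| <= #|A :\ w|.+1 by rewrite (cardsD1 w A); case: (_ \in _).
have cM1 : k <= #|M1|.+2 by have := cD f (N u :\ x); have := cD x (N u); rewrite -/M1; clear -kNu; lia.
have cM2 : k <= #|M2|.+3.
  rewrite /M2 setUC -setDDl; have := cD d1 ((N x :\ u) :\ d2); have := cD d2 (N x :\ u).
  by have := cD u (N x); clear -kNx; lia.
have cM1S : k <= #|out u :\ x| + #|M1 :\: (out u :\ x)|.+1.
  have -> : M1 :\: (out u :\ x) = ((N u :\ x) :\: (out u :\ x)) :\ f by rewrite !setDDl (setUC [set f]).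
  by have := cD f ((N u :\ x) :\: (out u :\ x)); clear -kS1; lia.
have cM2S : k <= #|out x :\ u| + #|M2 :\: (out x :\ u)|.+1.
  (* As [d1] is itself a head of [x], only [d2] is lost outside the heads. *)
  have -> : M2 :\: (out x :\ u) = ((N x :\ u) :\: (out x :\ u)) :\ d2.
    apply/setP=> w; rewrite !inE; case: (eqVneq w d1) => [-> | _] /=; last first.
      by case: (w == d2); rewrite /= ?andbF.
    by move: d1x; rewrite inE => ->; case: (d1 == u); rewrite /= ?andbF.
  by have := cD d2 ((N x :\ u) :\: (out x :\ u)); clear -kS2; lia.
have [||||||y0 [B1 [B2 [y0f km B1P B2P]]]] :=
  @two_hub_kmodel V O O_irr u x (out x :\ u) M1 M2 f ux (subxx _) (subsetDl _ _) (subsetDl _ _); try (clear -a2 b2 ab cM1 cM2 cM1S cM2S; lia).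
have linkE p : p.1 \in M1 -> O p.1 p.2 -> p.2 != u -> arc_adj (u, x) p.
  case: p => w t /=; rewrite !inE => /and3P[_ wx uw] Ow tu.
  by rewrite arc_adjE // (core_adj_adj uw) tu eq_sym wx.
have dis1 y p : y \in out u :\ x -> p \in B1 y -> p \notin E.
  move=> yS pB; apply/negP=> pE; have [_ /(_ p pB) pP _] := B1P y yS.
  case: pP => [py | [pM Op pu]].
    move: pE; rewrite py => /EZ[[yx]|[]]; last by rewrite eqxx.
    by rewrite yx !inE eqxx in yS.
  by have := f_only p pE (linkE p pM Op pu) => pf'; rewrite pf' !inE eqxx in pM.
have dis2 z p : z \in out x :\ u -> p \in B2 z -> p \notin E.
  move=> zS pB; apply/negP=> pE; have [_ /(_ p pB)] := B2P z zS.
  case=> [pz | [pM Op px]].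
    move: pE; rewrite pz => /EZ[[xu _]|[_]]; last by rewrite eqxx.
    by have := u_x; rewrite xu eqxx.
  move: (pM); rewrite in_setD in_setD1 [p.1 \in N x]inE => /and3P[/negP nd pu xp].
  apply: nd; exact: d_only pE Op (core_adj_adj xp) px pu.
eexists _, _; split; last first.
  apply: (kmodel_option _ km _ E_conn).
  - exact: arc_adj_sym.
  - by apply/set0Pn; exists (u, x).
  - by case=> [y|z] p; [apply: dis1 (valP y) | apply: dis2 (valP z)].
  case=> [[y yS]|[z zS]] /=.
    have [uB _ Bl] := B1P y yS; have [yy0|/Bl[p pB [pM Op pu]]] := eqVneq y y0; last first.
      by exists p, (u, x); rewrite arc_adj_sym linkE.
    (* The set of [y0] has no link arc to touch [(u, x)], so it must touch [pf]; this is why [y0]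
       has to differ from [f]. *)
    exists (u, y), pf; split=> //; move: uxpf; rewrite /Submission.arc_adj /= pf1 yy0 y0f.
    by move: yS; rewrite yy0 !inE => /andP[_ ->] /and5P[_ -> -> _ ->].
  by have [xB _] := B2P z zS; have [p pE xzp] := Etouch z zS; exists (x, z), p.
by rewrite card_option card_sum_sig ab.
Qed.

End Bridge.

(** * Brooks' theorem *)

Section Brooks.
Variables (T : finType) (e : rel T) (k : nat) (H : {set T}).
Hypotheses (e_sym : symmetric e) (e_irr : irreflexive e).
Hypotheses (k3 : 2 < k) (Hcrit : crit e k H).
Hypothesis deg : forall x, x \in H -> #|nbr e H x| = k.
Implicit Types (c : T -> 'I_k) (s t : seq T) (S : {set T}).

Lemma crit_connected : connected_in e H.
Proof.
move=> a b aH bH; apply: contraT => nab; set r := [rel _ _ | _] in nab.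
pose A := [set z in H | connect r a z].
have aA : a \in A by rewrite inE aH connect0.
have bA : b \notin A by rewrite inE (negPf nab) andbF.
have AH : A \subset H by apply/subsetP=> z; rewrite inE => /andP[].
have [|c1 c1P] := crit_proper (S := H :\: A) Hcrit.
  apply/properP; split; first exact: subsetDl.
  by exists a; rewrite // inE aA.
have [|c2 c2P] := crit_proper (S := A) Hcrit.
  by apply/properP; split=> //; exists b.
have closedA z w : z \in A -> w \in H -> e z w -> w \in A.
  move=> zA wH zw; move: (zA); rewrite !inE wH => /andP[zH az] /=.
  by apply: connect_trans az (connect1 _); rewrite /= zH wH.
have [/negP[]] := Hcrit; apply/kcolP.
exists (fun z => if z \in A then c2 z else c1 z) => z w zH wH zw.
case: ifP => zA; case: ifP => wA.
- exact: c2P.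
- by rewrite (closedA z w) in wA.
- by rewrite e_sym in zw; rewrite (closedA w z) in zA.
- by apply: c1P; rewrite // inE ?zA ?wA.
Qed.

Lemma extend_uncoloured_nbr S c x y : proper_on e S c -> x \in H -> y \in H -> y \notin S -> e x y ->
  S \subset H -> x \notin S ->
  exists c', proper_on e (x |: S) c' /\ {in S, c' =1 c}.
Proof.
move=> cP xH yH yS xy SH xS; have [|c' [c'P c'E]] := proper_ext e_sym e_irr (x := x) cP.
  apply: leq_ltn_trans (leq_imset_card _ _) _.
  rewrite -(deg xH) (cardsD1 y (nbr e H x)) inE yH xy ltnS; apply: subset_leq_card.
  apply/subsetP=> z; rewrite !inE => /andP[zS ->]; rewrite (subsetP SH) // !andbT.
  by apply: contraNneq yS => <-.
by exists c'; split=> // z zS; apply: c'E; apply: contraNneq xS => <-.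
Qed.

(** Greedy colouring from the front of [t]: each vertex still has its uncoloured successor among its
    [k] neighbours, and so sees fewer than [k] colours. *)
Lemma extend_along S c t y : proper_on e S c -> S \subset H ->
    sorted e (rcons t y) -> uniq (rcons t y) -> all (mem (H :\: S)) (rcons t y) ->
  exists c', proper_on e (S :|: [set z in t]) c' /\ {in S, c' =1 c}.
Proof.
elim: t S c => [|v t IHt] S c cP SH.
  by exists c; split=> //; rewrite (_ : [set z in [::]] = set0) ?setU0 //; apply/setP=> z; rewrite !inE.
rewrite rcons_cons /= => vt /andP[v_t t_uniq] /andP[/setDP[vH vS] tHS].
have [w [wt vw]] : exists w, w \in rcons t y /\ e v w.
  case: (t) vt => [|w t'] /= /andP[vw _]; first by exists y; rewrite mem_head.
  by exists w; rewrite mem_head.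
have /setDP[wH wS] := allP tHS w wt.
have [c1 [c1P c1E]] := extend_uncoloured_nbr cP vH wH wS vw SH vS.
have [| | c2 [c2P c2E]] := IHt (v |: S) c1 c1P _ (path_sorted vt) t_uniq.
- by rewrite subUset sub1set vH.
- apply/allP=> z zt; have := allP tHS z zt; rewrite /= !inE negb_or => /andP[-> ->].
  by rewrite !andbT; apply: contraNneq v_t => <-.
exists c2; split.
  rewrite (_ : S :|: _ = v |: S :|: [set z in t]) //.
  by apply/setP=> z; rewrite !inE orbCA orbA.
by move=> z zS; rewrite c2E ?c1E // !inE zS orbT.
Qed.

(** Two neighbours of the same colour would leave a colour free for [v], and so colour all of
    [H]. *)
Lemma last_vertex c v y z : proper_on e (H :\ v) c -> v \in H -> y \in H -> z \in H ->
  e v y -> e v z -> y != z -> c y != c z.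
Proof.
move=> cP vH yH zH vy vz yz; apply/eqP=> cyz.
have [/negP[]] := Hcrit; apply/kcolP.
have [|c' [c'P _]] := proper_ext e_sym e_irr (x := v) cP; last by exists c'; rewrite setD1K in c'P.
have v_z : z != v by apply: contraTneq vz => ->; rewrite e_irr.
have v_y : y != v by apply: contraTneq vy => ->; rewrite e_irr.
have /subset_leq_card/leq_ltn_trans-> // : c @: nbr e (H :\ v) v \subset c @: (nbr e H v :\ z).
  apply/subsetP=> i /imsetP[w]; rewrite !inE => /andP[/andP[_ wH] vw] ->.
  have [-> | wz] := eqVneq w z; first by rewrite -cyz imset_f // !inE yz yH.
  by rewrite imset_f // !inE wz wH.
apply: leq_ltn_trans (leq_imset_card _ _) _.
by rewrite -(deg vH) (cardsD1 z (nbr e H v)) inE zH vz.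
Qed.

(** Suppose that [x] has no neighbour off the cycle. Colour everything off the cycle, give [x] the
    colour of [z], and colour greedily along the cycle from [x] back to [y]: then [y] has the
    neighbours [x] and [z] of equal colour, against [last_vertex]. *)
Lemma no_closed_path x y s z : path e y (rcons s x) -> e x y -> uniq (y :: rcons s x) ->
    all (mem H) (y :: rcons s x) -> z \in H -> z \notin y :: rcons s x -> e y z ->
  exists2 w, w \in H :\: [set v in y :: rcons s x] & e x w.
Proof.
move=> yp xy p_uniq pH zH zp yz; set p := y :: rcons s x in p_uniq pH zp *.
have [w wP | no_out] := pickP [pred w in H :\: [set v in p] | e x w].
  by exists w; case/andP: wP.
have yp' : y \in p by rewrite mem_head.
have xp : x \in p by rewrite inE mem_rcons mem_head orbT.
have xH : x \in H := allP pH x xp; have yH : y \in H := allP pH y yp'.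
have [|c0 c0P] := crit_proper (S := H :\: [set v in p]) Hcrit.
  by apply/properP; split; [exact: subsetDl | exists y; rewrite // !inE eqxx].
set S0 := H :\: _ in c0P no_out.
have zS0 : z \in S0 by rewrite 2!inE zp.
pose c1 w := if w == x then c0 z else c0 w.
have c1P : proper_on e (x |: S0) c1.
  move=> v w; rewrite /c1 !in_setU1; case: (eqVneq v x) => [->|vx] /= vS; case: (eqVneq w x) => [->|wx] /= wS vw.
  - by rewrite e_irr in vw.
  - by have := no_out w; rewrite /= wS vw.
  - by have := no_out v; rewrite /= vS e_sym vw.
  - exact: c0P.
have x_s : (x \notin s) /\ uniq s by move: p_uniq; rewrite /= rcons_uniq => /and3P[].
have y_s : (y \notin s) /\ y != x by move: p_uniq; rewrite /= mem_rcons inE negb_or => /andP[/andP[]].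
have [| | | | c2 [c2P c2E]] := extend_along (t := rev s) (y := y) c1P.
- by rewrite subUset sub1set xH subsetDl.
- rewrite -rev_cons rev_sorted; apply: sub_sorted (_ : sorted e (y :: s)).
    by move=> a b; rewrite e_sym.
  by move: yp; rewrite rcons_path => /andP[].
- by rewrite rcons_uniq rev_uniq mem_rev; case: x_s => _ ->; case: y_s => ->.
- apply/allP=> v; rewrite mem_rcons inE mem_rev => vs.
  have vp : v \in p by rewrite inE mem_rcons inE; case/predU1P: vs => [->|->]; rewrite ?eqxx ?orbT.
  have vH : v \in H := allP pH v vp.
  rewrite /= in_setD vH andbT in_setU1 negb_or in_setD inE vp /= andbT.
  case/predU1P: vs => [->|vs]; first by case: y_s.
  by apply: contraNneq (proj1 x_s) => <-.
have : proper_on e (H :\ y) c2.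
  apply: proper_onS c2P; apply/subsetP=> v; rewrite !inE mem_rcons inE mem_rev.
  by case/andP=> /negPf-> ->; case: (v == x); case: (v \in s).
move/last_vertex/(_ yH xH zH); rewrite e_sym in xy; move/(_ xy yz).
have xz : x != z by apply: contraNneq zp => <-.
by move/(_ xz); rewrite !c2E ?in_setU1 ?eqxx ?zS0 ?orbT // /c1 eqxx; case: (z == x); rewrite eqxx.
Qed.

Lemma no_spanning_path a b d t : sorted e [:: a, b, d & t] -> uniq [:: a, b, d & t] ->
    all (mem H) [:: a, b, d & t] -> H \subset [set v in [:: a, b, d & t]] ->
  e a d.
Proof.
move=> p_path p_uniq pH Hp; have /and3P[ab bd dt] : [&& e a b, e b d & path e d t] := p_path.
apply: contraT => nad.
have inH v : (v \in [:: a, b, d & t]) -> v \in H by move/(allP pH).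
have bH : b \in H by apply: inH; rewrite !inE eqxx orbT.
have [v] : exists v, v \in nbr e H b :\: [set a; d].
  apply/set0Pn; rewrite -card_gt0; have := cardsID [set a; d] (nbr e H b).
  have := subset_leq_card (subsetIr (nbr e H b) [set a; d]).
  by rewrite (deg bH) cards2; case: (_ != _) => /=; clear -k3; lia.
rewrite !inE negb_or => /andP[/andP[va vd] /andP[vH bv]].
have vt : v \in t.
  have := subsetP Hp v vH; rewrite !inE (negPf va) (negPf vd) /=.
  by case: eqVneq bv => [->|//]; rewrite e_irr.
have [t1 [t2 tE]] : exists t1 t2, t = t1 ++ v :: t2.
  exists (take (index v t) t), (drop (index v t).+1 t).
  by rewrite -(drop_index vt) cat_take_drop.
have k0 : 0 < k := ltnW (ltnW k3).
have c0P : proper_on e [set a; d] (fun _ => Ordinal k0).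
  by move=> x y /set2P[]-> /set2P[]->; rewrite ?e_irr // ?(negPf nad) // e_sym (negPf nad).
have := p_uniq; rewrite /= !inE !negb_or => /and4P[/and3P[a_b a_d a_t] /andP[b_d b_t] d_t t_uniq].
have tP w : w \in t -> [/\ w != a, w != b, w != d & w \in H].
  move=> wt; split; last by apply: inH; rewrite !inE wt !orbT.
  - by apply: contraNneq a_t => <-.
  - by apply: contraNneq b_t => <-.
  - by apply: contraNneq d_t => <-.
have tE' : t = rcons t1 v ++ t2 by rewrite cat_rcons.
have t1_t w : w \in rcons t1 v -> w \in t by rewrite tE' mem_cat => ->.
have t2_t w : w \in v :: t2 -> w \in t by rewrite tE mem_cat orbC => ->.
have aH : a \in H by apply: inH; rewrite mem_head.
have dH : d \in H by apply: inH; rewrite !inE eqxx !orbT.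
have t1_v w : w \in t1 -> w \notin v :: t2.
  move: t_uniq; rewrite tE cat_uniq => /and3P[_ /hasPn t12 _] wt1.
  by apply/negP=> /t12/negP[].
have [| | | | c1 [c1P c1E]] := extend_along (t := t1) (y := v) c0P.
- by apply/subsetP=> w /set2P[]->.
- by move: dt; rewrite tE' cat_path => /andP[/path_sorted].
- by move: t_uniq; rewrite tE' cat_uniq => /andP[].
- apply/allP=> w /t1_t/tP[wa _ wd wH]; rewrite /= in_setD wH andbT.
  by rewrite in_set2 negb_or wa.
have [| | | | c2 [c2P c2E]] := extend_along (t := rev (v :: t2)) (y := b) c1P.
- rewrite subUset; apply/andP; split; first by apply/subsetP=> w /set2P[]->.
  apply/subsetP=> w; rewrite inE => wt1.
  by have [|] := tP w; rewrite // tE mem_cat wt1.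
- rewrite -rev_cons rev_sorted; apply: sub_sorted (_ : sorted e [:: b, v & t2]).
    by move=> w w'; rewrite e_sym.
  rewrite /= bv; move: dt; rewrite tE cat_path /= => /and3P[] //.
- rewrite rcons_uniq mem_rev rev_uniq; apply/andP; split.
    by apply/negP=> /t2_t/tP[_]; rewrite eqxx.
  by move: t_uniq; rewrite tE cat_uniq => /and3P[].
- apply/allP=> w; rewrite mem_rcons inE mem_rev => wt.
  rewrite /= in_setD in_setU in_set2 inE; case/predU1P: wt => [->|wt].
    rewrite bH andbT !negb_or eq_sym a_b b_d /=.
    by apply: contra b_t => bt1; rewrite tE mem_cat bt1.
  have [wa _ wd ->] := tP _ (t2_t _ wt); rewrite andbT !negb_or wa wd /=.
  by apply: contraL wt; apply: t1_v.
have : proper_on e (H :\ b) c2.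
  apply: proper_onS c2P; apply/subsetP=> w; rewrite !inE mem_rev.
  case/andP=> wb /(subsetP Hp); rewrite !inE (negPf wb) tE mem_cat inE.
  by case: (w == a); case: (w == d); case: (w \in t1).
move/last_vertex/(_ bH aH dH); rewrite e_sym ab => /(_ isT bd a_d).
have c2_const w : w \in [set a; d] -> c2 w = Ordinal k0.
  by move=> wS; rewrite c2E ?c1E // in_setU wS.
by rewrite !c2_const ?set21 ?set22 ?eqxx.
Qed.

Lemma crossing (r : rel T) (A : {set T}) a b : connect r a b -> a \in A -> b \notin A ->
  exists y z, [/\ y \in A, z \notin A & r y z].
Proof.
case/connectP=> p; elim: p a => [|z p IHp] a /= => [_ -> -> //|/andP[az zp] bE aA bA].
by have [zA | zA] := boolP (z \in A); [apply: IHp zp bE zA bA | exists a, z].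
Qed.

Lemma first_split (p : pred T) s : has p s ->
  exists s1 x s2, [/\ s = s1 ++ x :: s2, p x & ~~ has p s1].
Proof.
by move/split_find; case=> x s1 s2 px ns1; exists s1, x, s2; rewrite cat_rcons.
Qed.

(** The first neighbour [w] of [v] on the path closes a cycle that contains all neighbours of [v].
    If a vertex were left out, connectedness gives a first cycle vertex [y] after [v] with a
    neighbour off the cycle; its predecessor has none, against [no_closed_path]. *)
Lemma closed_end_spans v s : sorted e (rcons s v) -> uniq (rcons s v) ->
    all (mem H) (rcons s v) -> (forall z, z \in H -> e v z -> z \in s) ->
  H \subset [set y in rcons s v].
Proof.
move=> p_path p_uniq pH v_end; apply/subsetP=> z zH; rewrite inE.
have vH : v \in H by apply: (allP pH); rewrite mem_rcons mem_head.
apply: contraT => z_out.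
have [s1 [w [q [sE vw nvs1]]]] : exists s1 w q, [/\ s = s1 ++ w :: q, e v w & ~~ has (e v) s1].
  apply: first_split; have /card_gt0P[w] : 0 < #|nbr e H v| by rewrite deg //; apply: ltnW (ltnW k3).
  by rewrite inE => /andP[wH vw]; apply/hasP; exists w; rewrite ?v_end.
have sE' : rcons s v = s1 ++ w :: rcons q v by rewrite sE rcons_cat.
have wq_path : path e w (rcons q v) by move: p_path; rewrite sE' => /cat_sorted2[].
pose A := [set y in v :: w :: q].
have As y : y \in A -> y \in rcons s v.
  by rewrite inE sE' mem_cat !inE mem_rcons inE; case/or3P=> ->; rewrite ?orbT.
have AH y : y \in A -> y \in H by move/As/(allP pH).
pose leaves y := [exists z' in H :\: A, e y z'].
have v_stays : ~~ leaves v.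
  apply/exists_inPn=> z'; rewrite !inE => /andP[z'A z'H]; apply/negP=> vz'.
  have := v_end z' z'H vz'; rewrite sE mem_cat => /orP[z's1|]; last first.
    by rewrite inE => z'wq; rewrite z'wq orbT in z'A.
  by case/hasP: nvs1; exists z'.
have /first_split[t1 [y [t2 [tE y_leaves t1_stay]]]] : has leaves (w :: q).
  have zA : z \notin A by apply: contra z_out => /As.
  have vA : v \in A by rewrite inE mem_head.
  have [y [z' [yA z'A /andP[/andP[_ z'H] yz']]]] := crossing (crit_connected vH zH) vA zA.
  have y_leaves : leaves y by apply/exists_inP; exists z'; rewrite // in_setD z'A.
  apply/hasP; exists y => //; move: yA; rewrite inE in_cons; case: eqVneq => // yv.
  by rewrite yv (negPf v_stays) in y_leaves.
have cyc : path.cycle e (v :: w :: q) by rewrite /= vw.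
have A_uniq : uniq (v :: w :: q).
  move: p_uniq; rewrite sE' cat_uniq -rcons_cons rcons_uniq => /and3P[_ _].
  by [].
(* Rotated so that the cycle starts at [y] and ends at the predecessor of [y]. *)
have rotE : rot (size (v :: t1)) (v :: w :: q) = y :: rcons (t2 ++ belast v t1) (last v t1).
  by rewrite tE -cat_cons rot_size_cat /= -cats1 -catA cats1 -lastI.
have /existsP[z' /andP[z'P yz']] := y_leaves.
have [z'H z'A] : z' \in H /\ z' \notin A by case/setDP: z'P.
have AE : A = [set a in y :: rcons (t2 ++ belast v t1) (last v t1)].
  by apply/setP=> a; rewrite -rotE !inE mem_rot !inE.
have := cyc; rewrite -(rot_cycle (size (v :: t1))) rotE /= rcons_path last_rcons => /andP[y_path xy].
have [|||a] := no_closed_path y_path xy _ _ z'H _ yz'.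
- by rewrite -rotE rot_uniq.
- by apply/allP=> a aP; apply: AH; rewrite AE inE.
- by move: z'A; rewrite AE inE.
rewrite -AE => aP xa; have : leaves (last v t1) by apply/exists_inP; exists a.
have := mem_last v t1; rewrite in_cons => /predU1P[->|lt1 l_leaves]; first by rewrite (negPf v_stays).
by case/hasP: t1_stay; exists (last v t1).
Qed.

(* A longest path [a, b, d, ...] with non-adjacent [a], [d] spans [H].  Let [v] be another
   neighbour of [b].  Giving [a] and [d] the same colour, one can colour greedily from [d]
   towards [v], then from the end of the path back to [v], and [b] last. *)
Theorem brooks : {in H &, forall x y, x != y -> e x y}.
Proof.
move=> x y xH yH xy; apply: contraT => nxy.
have [a [b [d [aH bH dH [ab bd a_d nad]]]]] : exists a b d,
    [/\ a \in H, b \in H, d \in H & [/\ e a b, e b d, a != d & ~~ e a d]].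
  have [|| b [d [bA dA /andP[/andP[bH dH] bd]]]] :=
    @crossing _ [set z in H | (z == x) || e x z] x y (crit_connected xH yH).
  - by rewrite inE xH eqxx.
  - by rewrite inE yH /= negb_or eq_sym xy.
  move: bA dA; rewrite !inE bH dH /= negb_or => /predU1P[bx|xb] /andP[dx nxd].
    by rewrite bx (negPf nxd) in bd.
  by exists x, b, d; rewrite eq_sym.
pose good t := [&& sorted e [:: a, b, d & t], uniq [:: a, b, d & t] & all (mem H) [:: a, b, d & t]].
have b_ad : (a != b) && (b != d).
  by rewrite (contraTneq _ ab) ?(contraTneq _ bd) // => ->; rewrite e_irr.
have good0 : good [::].
  by case/andP: b_ad => a_b b_d; rewrite /good /= ab bd aH bH dH !inE negb_or a_b a_d b_d.
have [| n t_small |n [t tP tn] maxn] := @max_natP (fun n => exists2 t, good t & size t = n) #|T|.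
- by exists 0, [::].
- case: t_small => t /and3P[_ t_uniq _] <-.
  apply: leq_trans (max_card (mem [:: a, b, d & t])).
  by rewrite (card_uniqP t_uniq); do 3!apply: leqW.
have /and3P[p_path p_uniq pH] := tP.
suff Hp : H \subset [set v in [:: a, b, d & t]].
  by have := no_spanning_path p_path p_uniq pH Hp; rewrite (negPf nad).
have pE : [:: a, b, d & t] = rcons (belast a [:: b, d & t]) (last d t) by rewrite -lastI.
rewrite pE in p_path p_uniq pH *; apply: closed_end_spans => // z zH vz.
apply: contraT => z_out; have : good (rcons t z).
  have zp : z \notin [:: a, b, d & t].
    rewrite pE mem_rcons inE negb_or z_out andbT.
    by apply: contraTneq vz => ->; rewrite e_irr.
  rewrite -pE in p_path p_uniq pH; rewrite /good -!rcons_cons rcons_uniq zp p_uniq all_rcons pH /= zH.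
  by move: p_path; rewrite /= rcons_path vz => /and3P[-> -> ->].
move=> gz; have /maxn : exists2 t', good t' & size t' = n.+1.
  by exists (rcons t z); rewrite // size_rcons tn.
by rewrite ltnn.
Qed.

End Brooks.

(** * Regular tournaments *)

Section Tournament.
Variables (V : finType) (O : rel V) (H : {set V}) (m : nat).
Hypothesis O_irr : irreflexive O.
Hypothesis O_total : {in H &, forall x y, x != y -> O x y || O y x}.
Hypothesis O_asym : {in H &, forall x y, O x y -> ~~ O y x}.
Hypothesis O_closed : {in H, forall x y, O x y -> y \in H}.
Hypothesis O_reg : {in H, forall x, #|out O x| = m}.

Local Notation n := #|H|.
Local Notation ev := (@enum_val V (mem H)).

Section Permutation.
Import GRing.Theory Num.Theory.
Local Open Scope ring_scope.

Let A : 'M[rat]_n := \matrix_(i, j) (O (ev i) (ev j))%:R.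

(* If [v *m A = 0] then the coordinates of [v] sum to 0 by regularity, and
   [A + A^T] is the all-one matrix minus the identity, so that
   [0 = v *m (A + A^T) *m v^T] is minus the squared length of [v]. *)
Lemma regular_tournament_det : (0 < m)%N -> \det A != 0.
Proof.
move=> m0; apply/negP=> /det0P[v v0 vA].
have vA_j j : \sum_i v 0 i * A i j = 0 by have /matrixP/(_ 0 j) := vA; rewrite !mxE.
have rowA i : \sum_j A i j = m%:R.
  rewrite (eq_bigr (fun j => (ev j \in out O (ev i))%:R)); last first.
    by move=> j _; rewrite mxE inE.
  rewrite -natr_sum -(O_reg (enum_valP i)); congr _%:R.
  rewrite -(@big_enum_val _ 0%N addn _ (mem H) (fun y => (y \in out O (ev i)) : nat)).
  rewrite (eq_bigr (fun y => if y \in out O (ev i) then 1%N else 0%N)); last first.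
    by move=> y _; case: (y \in _).
  rewrite -big_mkcondr sum1dep_card; apply: eq_card => y; rewrite !inE.
  by case Oy: (O _ y); rewrite ?andbF // (O_closed (enum_valP i) Oy).
have sum_v : \sum_i v 0 i = 0.
  have : \sum_j \sum_i v 0 i * A i j = 0 by rewrite big1.
  rewrite exchange_big /= (eq_bigr (fun i => v 0 i * m%:R)); last first.
    by move=> i _; rewrite -mulr_sumr rowA.
  by rewrite -mulr_suml => /eqP; rewrite mulf_eq0 pnatr_eq0 (gtn_eqF m0) orbF => /eqP.
have q0 : \sum_i \sum_j v 0 i * v 0 j * A i j = 0.
  rewrite exchange_big /= big1 // => j _.
  by rewrite (eq_bigr (fun i => v 0 i * A i j * v 0 j)) -?mulr_suml ?vA_j ?mul0r // => i _; rewrite mulrAC.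
have q0' : \sum_i \sum_j v 0 i * v 0 j * A j i = 0.
  by rewrite exchange_big /= -[RHS]q0; apply: eq_bigr => i _; apply: eq_bigr => j _; rewrite [v 0 j * _]mulrC.
have AT i j : A i j + A j i = 1 - (i == j)%:R.
  rewrite !mxE; have [<-|ij] := eqVneq i j; first by rewrite O_irr addr0 subrr.
  have ev_ij : ev i != ev j by rewrite (inj_eq enum_val_inj).
  have := O_total (enum_valP i) (enum_valP j) ev_ij.
  rewrite mulr0n subr0; case Oij : (O _ _) => /=; last by move=> ->; rewrite add0r.
  by have /negPf-> := O_asym (enum_valP i) (enum_valP j) Oij; rewrite addr0.
have sq0 : \sum_i v 0 i ^+ 2 = 0.
  have : \sum_i \sum_j v 0 i * v 0 j * (A i j + A j i) = 0.
    rewrite -[RHS](addr0 0) -[X in _ = X + _]q0 -[X in _ = _ + X]q0' -big_split /=.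
    by apply: eq_bigr => i _; rewrite -big_split; apply: eq_bigr => j _; rewrite mulrDr.
  rewrite (eq_bigr (fun i => v 0 i * (\sum_j v 0 j) - v 0 i ^+ 2)).
    by rewrite sumrB -mulr_suml sum_v mul0r sub0r => /eqP; rewrite oppr_eq0 => /eqP.
  move=> i _; rewrite mulr_sumr (bigD1 i) //= [X in _ = X - _](bigD1 i) //=.
  rewrite AT eqxx subrr mulr0 add0r expr2 addrAC subrr add0r.
  by apply: eq_bigr => j ji; rewrite AT eq_sym (negPf ji) subr0 mulr1.
case/negP: v0; apply/eqP/rowP=> i; rewrite mxE.
have /psumr_eq0P := sq0 => /(_ (fun i _ => sqr_ge0 _) i isT)/eqP.
by rewrite sqrf_eq0 => /eqP.
Qed.

(** A non-zero determinant has a non-zero term in its expansion over permutations, and that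
    permutation follows arcs. *)
Lemma cycle_factor : (0 < m)%N -> exists s : {perm 'I_n}, forall i, O (ev i) (ev (s i)).
Proof.
move=> m0.
suff /existsP[s /forallP sP] : [exists s : {perm 'I_n}, [forall i, O (ev i) (ev (s i))]] by exists s.
apply: contraNT (regular_tournament_det m0); rewrite negb_exists => /forallP no_s.
rewrite /determinant big1 // => s _; have /forallPn[i /negPf nOi] := no_s s.
by rewrite (bigD1 i) //= mxE nOi mul0r mulr0.
Qed.

End Permutation.

(** The first arcs of the sets [i] and [j] touch unless [j] is [s i] or [i] is [s j]. In these cases
    the second arcs touch, because [g] avoids [s] and there are no digons. *)
Lemma tournament_kmodel : 1 < m -> has_kmodel (arc_adj O) #|H|.
Proof.
move=> m2; have [s sP] := cycle_factor (ltnW m2).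
pose g i := link_head O (ev i) (ev (s i)).
have gP i : O (ev i) (g i) /\ g i != ev (s i).
  apply: link_headP; have /subsetPn[y] : ~~ (out O (ev i) \subset [set ev (s i)]).
    by apply/negP=> /subset_leq_card; rewrite cards1 (O_reg (enum_valP i)) leqNgt m2.
  by rewrite !inE => Oy ys; apply/existsP; exists y; rewrite Oy.
have back i : ~~ O (ev (s i)) (ev i) by apply: O_asym (sP i); apply: enum_valP.
have adjP i j : i != j -> adj O (ev i) (ev j).
  by move=> ij; rewrite /adj O_total ?enum_valP // (inj_eq enum_val_inj).
have head_neq i y : O (ev (s i)) y -> y != ev i by apply: contraTneq => ->.
pose B i := [set (ev (s i), ev (s (s i))); (ev i, g i)].
exists _, B; split; first by rewrite card_ord.
have s_i i : s i != i by apply: contraTneq (sP i) => ->; rewrite O_irr.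
split.
- by move=> i; apply/set0Pn; exists (ev i, g i); rewrite set22.
- move=> i; apply: connected_in2; first exact: arc_adj_sym.
  have [Og gs] := gP i; rewrite arc_adjE // adjP // gs andbT.
  exact: head_neq.
- move=> i j p /set2P[]-> /set2P[] [] /enum_val_inj.
  + by move/perm_inj.
  + by move=> <- /esym/eqP; have [_ /negPf->] := gP (s i).
  + by move=> -> /eqP; have [_ /negPf->] := gP (s j).
  + by [].
move=> i j ij.
have B1 a : (ev (s a), ev (s (s a))) \in B a by rewrite set21.
have B2 a : (ev a, g a) \in B a by rewrite set22.
have step a : arc_adj O (ev a, g a) (ev (s a), g (s a)).
  have [Og gs] := gP a; have [Og' gs'] := gP (s a).
  by rewrite arc_adjE // adjP ?gs ?head_neq // eq_sym s_i.
have [jE | ji] := eqVneq j (s i).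
  by exists (ev i, g i), (ev j, g j); split=> //; rewrite jE step.
have [iE | ij'] := eqVneq i (s j).
  by exists (ev i, g i), (ev j, g j); split=> //; rewrite iE arc_adj_sym step.
exists (ev (s i), ev (s (s i))), (ev (s j), ev (s (s j))); split=> //.
rewrite arc_adjE // adjP ?(inj_eq perm_inj) //= !(inj_eq enum_val_inj) !(inj_eq perm_inj).
by rewrite [s i == j]eq_sym ji [s j == i]eq_sym ij'.
Qed.

End Tournament.

(** * Counting arcs in a critical set *)

Lemma sum_pair_l (V : finType) (H : {set V}) (Q : rel V) (F : V -> V -> nat) :
    (forall u x, Q u x -> u \in H) ->
  \sum_(p | Q p.1 p.2) F p.1 p.2 = \sum_(u in H) \sum_(x | Q u x) F u x.
Proof.
move=> QH; rewrite pair_big_dep /=; apply: eq_bigl => -[u x] /=.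
by case Qux: (Q u x); rewrite ?andbF // (QH _ _ Qux).
Qed.

Lemma sum_pair_r (V : finType) (H : {set V}) (Q : rel V) (F : V -> V -> nat) :
    (forall u x, Q u x -> x \in H) ->
  \sum_(p | Q p.1 p.2) F p.1 p.2 = \sum_(x in H) \sum_(u | Q u x) F u x.
Proof.
move=> QH; rewrite (@sum_pair_l _ setT) // (exchange_big_dep (mem H)) /=; last first.
  by move=> u x _; apply: QH.
by apply: eq_bigr => x _; apply: eq_bigl => u; rewrite inE.
Qed.

Lemma leq_sum_eq (I : finType) (P : pred I) (F G : I -> nat) :
    (forall i, P i -> F i <= G i) -> \sum_(i | P i) G i <= \sum_(i | P i) F i ->
  forall i, P i -> F i = G i.
Proof.
move=> FG GF i Pi; apply/eqP; rewrite eqn_leq FG //= leqNgt; apply/negP=> FGi.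
move: GF; rewrite leqNgt (bigD1 i) //= [X in _ < X](bigD1 i) //= -addSn leq_add //.
by apply: leq_sum => j /andP[/FG].
Qed.

Section Counting.
Variables (V : finType) (O : rel V) (k : nat) (H : {set V}).
Hypothesis O_irr : irreflexive O.
Local Notation arc_adj := (arc_adj O).
Local Notation core_adj := (core_adj O).
Local Notation out := (out O).
Hypotheses (k4 : 3 < k) (Hcrit : crit core_adj k H).
Hypothesis H_slack : {in H, forall v, slack O k v}.
Hypothesis no_model : ~ has_kmodel arc_adj k.+1.

Let a v := #|out v|.
Let farc u x := [&& u \in H, x \in H, core_adj u x & O u x].
Let deg v := #|nbr core_adj H v|.
Let o v := #|[set x | farc v x]|.
Let i v := #|[set u | farc u v]|.
Let d v := #|[set x | farc v x & O x v]|.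
(** The exceptional arcs: [u] has a single head besides [x], too few for the two-hub models, and the
    out-degree sum is [k + 1] without a digon. *)
Let surplus u x := [&& farc u x, a u == 2, a x == k.-1 & ~~ O x u].
Let t v := #|[set u | surplus u v]|.
(* [charge v] is the contribution of [v] to the difference between the two sides when
   [a u + a x <= k + O x u + surplus u x] is summed over the arcs [(u, x)] of [farc]. *)
Let charge v := (deg v - k) * a v + k * (a v - o v) + (a v).-1 * d v.

Lemma deg_ge v : v \in H -> k <= deg v.
Proof. by apply: crit_deg => //; [apply: core_adj_sym | apply: core_adj_irr]. Qed.

Lemma a_lt v : v \in H -> a v < k.
Proof.
move=> vH; rewrite ltnNge; apply/negP=> kv; apply: no_model.
exact: star_hub_kmodel (H_slack vH) kv.
Qed.

Lemma a_gt0 v : v \in H -> 0 < a v.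
Proof.
move=> vH; have : 0 < deg v by apply: leq_trans (deg_ge vH); apply: leq_trans k4.
case/card_gt0P=> y; rewrite inE => /andP[_ /and3P[_ /existsP[z /andP[vz _]] _]].
by apply/card_gt0P; exists z; rewrite inE.
Qed.

Lemma has_out_but_card w x : has_out_but O w x -> 0 < #|out w :\ x|.
Proof.
by case/existsP=> s /andP[ws sx]; apply/card_gt0P; exists s; rewrite !inE sx.
Qed.

Lemma card_out_but w x : a w = O w x + #|out w :\ x|.
Proof. by rewrite /a (cardsD1 x) inE. Qed.

(** A sum equal to [k] is excluded by [bridge_kmodel] and a larger one by [double_hub_kmodel], with
    part of the heads of [x] dropped. *)
Lemma farc_small u x : farc u x -> 1 < #|out u :\ x| -> 1 < #|out x :\ u| ->
  #|out u :\ x| + #|out x :\ u| < k.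
Proof.
case/and4P=> uH xH ux Oux p2 q2; rewrite ltnNge leq_eqVlt; apply/negP=> /predU1P[kE | ltk].
  by apply: no_model; apply: (bridge_kmodel O_irr k4 Hcrit uH xH ux Oux) => //; apply: H_slack.
apply: no_model; apply: (@double_hub_kmodel _ _ _ O_irr u x (k.+1 - #|out u :\ x|)) => //.
- exact: H_slack.
- exact: H_slack.
- have := a_lt uH; rewrite (card_out_but u x) Oux add1n => pk.
  by clear -ltk pk; lia.
have := a_lt uH; rewrite (card_out_but u x) Oux add1n => pk.
by clear -pk; lia.
Qed.

Lemma farc_sum u x : farc u x -> a u + a x <= k + O x u + surplus u x.
Proof.
move=> fux; have small := farc_small fux; have /and4P[uH xH ux Oux] := fux.
have := has_out_but_card (proj1 (andP (proj2 (andP ux)))).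
have := has_out_but_card (proj2 (andP (proj2 (andP ux)))).
have := a_lt uH; have := a_lt xH; rewrite /surplus fux /=.
have := card_out_but u x; have := card_out_but x u; rewrite Oux.
move: small; move: #|out u :\ x| #|out x :\ u| (a u) (a x) => p q au ax.
move: (O x u) => b; clear -k4; case: b => /=; lia.
Qed.

(** Each core edge in [H] at [v] carries an arc, and exactly the digons are counted twice. *)
Lemma deg_split v : v \in H -> o v + i v = deg v + d v.
Proof.
move=> vH; rewrite /o /i -cardsUI; congr (_ + _); apply: eq_card => x; rewrite !inE /farc vH /=.
  rewrite [core_adj x v]core_adj_sym; case xH: (x \in H) => //=.
  by case vx: (core_adj v x) => //=; have := core_adj_adj vx; rewrite /adj.
rewrite [core_adj x v]core_adj_sym.
by case: (x \in H); case: (core_adj v x); case: (O v x); case: (O x v).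
Qed.

Lemma o_le v : o v <= a v.
Proof. by apply: subset_leq_card; apply/subsetP=> x; rewrite !inE => /and4P[]. Qed.

Lemma charge_def v : v \in H -> a v * (deg v + d v) = charge v + k * o v + d v.
Proof.
move=> vH; have := deg_ge vH; have := a_gt0 vH; have := o_le v; rewrite /charge.
move: (a v) (deg v) (d v) (o v) => av dv gv ov oa a1 kd.
have h1 : k * (av - ov) + k * ov = k * av by rewrite -mulnDr subnK.
have h2 : (dv - k) * av + k * av = dv * av by rewrite -mulnDl subnK.
have h3 : av.-1 * gv + gv = av * gv by rewrite addnC -mulSn prednK.
by rewrite mulnDr [av * dv]mulnC -h2 -h1 -h3; clear; lia.
Qed.

(** [farc_sum] is added up over all arcs and both sides are regrouped by vertices: [a v] is counted
    once for each arc of [farc] at [v], and [charge_def] cancels the common terms. *)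
Lemma charge_sum : \sum_(v in H) charge v <= \sum_(v in H) t v.
Proof.
have fl u x : farc u x -> u \in H by case/and4P.
have fr u x : farc u x -> x \in H by case/and4P.
have suml : \sum_(p | farc p.1 p.2) (a p.1 + a p.2) = \sum_(v in H) a v * (deg v + d v).
  rewrite big_split /= (@sum_pair_l _ H farc (fun u x => a u)) // (@sum_pair_r _ H farc (fun u x => a x)) //.
  rewrite -big_split; apply: eq_bigr => v vH /=; rewrite -deg_split // mulnDr.
  by rewrite !sum_nat_const mulnC [_ * a v]mulnC /o /i !cardsE.
have sumr : \sum_(p | farc p.1 p.2) (k + O p.2 p.1 + surplus p.1 p.2) =
    \sum_(v in H) (k * o v + d v + t v).
  rewrite !big_split /=; congr (_ + _ + _).
  - rewrite (@sum_pair_l _ H farc (fun u x => k)) //; apply: eq_bigr => v _.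
    by rewrite sum_nat_const mulnC /o cardsE.
  - rewrite (@sum_pair_l _ H farc (fun u x => O x u : nat)) //; apply: eq_bigr => v _.
    rewrite /d -sum1dep_card [RHS]big_mkcondr; apply: eq_bigr => x _.
    by case: (O x v).
  - rewrite (@sum_pair_r _ H farc (fun u x => surplus u x : nat)) //; apply: eq_bigr => v _.
    rewrite /t -sum1dep_card [RHS](eq_bigl (fun u => farc u v && surplus u v)).
      by rewrite [RHS]big_mkcondr; apply: eq_bigr => x _; case: (surplus x v).
    by move=> u; rewrite /surplus; case: (farc u v).
have : \sum_(p | farc p.1 p.2) (a p.1 + a p.2) <=
       \sum_(p | farc p.1 p.2) (k + O p.2 p.1 + surplus p.1 p.2).
  by apply: leq_sum => p; apply: farc_sum.
rewrite suml sumr (eq_bigr _ charge_def) !big_split /= => le.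
by rewrite -(leq_add2l (\sum_(v in H) k * o v + \sum_(v in H) d v)) addnC addnA.
Qed.

Lemma t_le v : v \in H -> t v <= deg v - o v.
Proof.
move=> vH; have <- : #|nbr core_adj H v :\: [set x | farc v x]| = deg v - o v.
  rewrite cardsD; congr (_ - _); apply: eq_card => x.
  by rewrite !inE /farc; case: (x \in H) => //=; rewrite ?andbF //; case: (core_adj v x); rewrite ?andbF.
apply: subset_leq_card; apply/subsetP=> u; rewrite !inE => /and4P[/and4P[-> _ uv _] _ _ nvu].
by rewrite core_adj_sym uv /farc (negPf nvu) !andbF.
Qed.

Lemma t_eq0 v : a v != k.-1 -> t v = 0.
Proof.
move=> av; apply/eqP; rewrite cards_eq0; apply/eqP/setP=> u.
by rewrite !inE /surplus (negPf av) !andbF.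
Qed.

Lemma t_charge v : v \in H ->
  (t v <= charge v /\ (t v = charge v -> charge v = 0)) \/
  [/\ a v = k.-1, t v = 1 & charge v = 0].
Proof.
move=> vH; have [av | /t_eq0->] := eqVneq (a v) k.-1; last by left; split.
have := t_le vH; have := deg_ge vH; have := o_le v; rewrite /charge av.
move: (deg v) (o v) (d v) (t v) => dv ov gv tv ole kd.
move=> tle.
(* [charge] contains the excess [e] with weight [k - 1], the heads [f] lost from [farc] with weight
   [k] and the digons with weight [k - 2], whereas [t] is at most [e + f + 1]. So [t] falls short of
   [charge] unless all three vanish. *)
have [e eE] : exists e, e = dv - k by exists (dv - k).
have [f fE] : exists f, f = k.-1 - ov by exists (k.-1 - ov).
rewrite -eE -fE.
have {}tle : tv <= (e + f).+1 by clear -tle eE fE kd; lia.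
have h1 : 3 * e <= e * k.-1 by rewrite mulnC leq_mul2l; apply/orP; right; clear -k4; lia.
have h2 : 4 * f <= k * f by rewrite leq_mul2r k4 orbT.
have h3 : 2 * gv <= k.-1.-1 * gv by rewrite leq_mul2r; apply/orP; right; clear -k4; lia.
case: (ltnP tv (e * k.-1 + k * f + k.-1.-1 * gv)) => [lt | ge].
  by left; split; [exact: ltnW | move=> tE; rewrite tE ltnn in lt].
have [e0 f0 g0] : [/\ e = 0, f = 0 & gv = 0].
  move: h1 h2 h3 tle ge; move: (e * k.-1) (k * f) (k.-1.-1 * gv) => x y z; clear.
  by move=> h1 h2 h3 tle ge; split; lia.
rewrite e0 f0 g0 mul0n !muln0 !addn0; rewrite e0 f0 in tle.
case: tv {ge} tle => [|[|//]] _; first by left.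
by right.
Qed.

(* The only vertices at which [t] can exceed [charge]; they force out-neighbours in [S1],
   whose own charge is far larger. *)
Let B0 := [set v in H | [&& a v == k.-1, t v == 1 & charge v == 0]].
Let S1 := [set v in H | a v == 1].

Lemma charge_eq0 v : v \in H -> charge v = 0 -> [/\ deg v = k, o v = a v & d v = 0].
Proof.
move=> vH /eqP; rewrite /charge !addn_eq0 !muln_eq0 -!andbA.
rewrite (gtn_eqF (a_gt0 vH)) orbF (gtn_eqF (ltnW (ltnW (ltnW k4)))) /= !subn_eq0.
case/and3P=> degk ao; have := deg_ge vH; have := o_le v => oa kdeg.
have -> : deg v = k by apply/eqP; rewrite eqn_leq degk.
have -> : o v = a v by apply/eqP; rewrite eqn_leq oa.
case/orP=> [/eqP a1 | /eqP->] //; split=> //.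
apply/eqP; rewrite cards_eq0; apply/eqP/setP=> x; rewrite !inE.
apply/negP=> /andP[/and4P[_ _ vx Ovx] _].
have := has_out_but_card (proj1 (andP (proj2 (andP vx)))).
by have := card_out_but v x; rewrite Ovx; clear -a1; lia.
Qed.

(** The only head of [w] cannot be a core neighbour, since a core edge needs another head; hence
    [o w] is 0. *)
Lemma S1_charge w : w \in S1 -> charge w = deg w.
Proof.
rewrite inE => /andP[wH /eqP aw]; have kdeg := deg_ge wH.
have ow : o w = 0.
  apply/eqP; rewrite cards_eq0; apply/eqP/setP=> x; rewrite !inE.
  apply/negP=> /and4P[_ _ wx Owx].
  have := has_out_but_card (proj1 (andP (proj2 (andP wx)))).
  by have := card_out_but w x; rewrite Owx aw; clear; lia.
by rewrite /charge ow aw subn0 !muln1 mul0n addn0 subnK.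
Qed.

Lemma closed_farc v : v \in H -> o v = a v -> [set x | farc v x] = out v.
Proof.
move=> vH ov; apply/eqP; rewrite eqEcard; apply/andP; split.
  by apply/subsetP=> x; rewrite !inE => /and4P[].
by rewrite -[#|out v|]/(a v) -ov.
Qed.

Lemma digon_free v w : farc v w -> d v = 0 -> ~~ O w v.
Proof.
move=> fvw /eqP; rewrite cards_eq0 => /eqP/setP/(_ w).
by rewrite !inE fvw /= => ->.
Qed.

(** Since [v] has [k - 2] heads besides [w], [farc_small] leaves [w] at most one head besides [v],
    and digons are excluded. *)
Lemma B0_out v w : v \in B0 -> w \in out v -> w \in S1 /\ v \in nbr core_adj H w.
Proof.
rewrite !inE => /and4P[vH /eqP av _ /eqP/(charge_eq0 vH)[degv ov dv]] Ovw.
have fvw : farc v w.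
  by have /setP/(_ w) := closed_farc vH ov; rewrite !inE Ovw.
have /and4P[_ wH vw _] := fvw; have nwv := digon_free fvw dv.
rewrite vH wH core_adj_sym vw; split=> //=.
have := farc_small fvw; have := card_out_but v w; have := card_out_but w v.
rewrite Ovw (negPf nwv) av add0n add1n; have := a_gt0 wH.
move: #|out v :\ w| #|out w :\ v| => p q; move: (a w) => aw; move: k4; clear; lia.
Qed.

(** Double counting: every vertex of [B0] sends [k - 1] arcs into [S1], where the charge is the core
    degree, so the charge of [S1] is at least [k - 1] times the size of [B0]. As [t] vanishes on
    [S1], [charge_sum] bounds the same charge by the size of [B0]. *)
Lemma B0_empty : B0 = set0.
Proof.
have B0S1 : [disjoint B0 & S1].
  rewrite -setI_eq0; apply/eqP/setP=> v; rewrite !inE; apply/negP.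
  by case/andP=> /and4P[_ /eqP-> _ _] /andP[_ /eqP]; move: k4; clear; lia.
have B0H : B0 \subset H by apply/subsetP=> v; rewrite inE => /andP[].
have S1H : S1 \subset H by apply/subsetP=> v; rewrite inE => /andP[].
have count : k.-1 * #|B0| <= \sum_(w in S1) charge w.
  rewrite (eq_bigr _ S1_charge) -(eq_bigr _ (fun w _ => sum1_card _)).
  have -> : k.-1 * #|B0| = \sum_(v in B0) \sum_(w in out v) 1.
    rewrite mulnC -sum_nat_const; apply: eq_bigr => v; rewrite sum1_card inE.
    by case/and4P=> _ /eqP.
  rewrite (exchange_big_dep (mem S1)) /=; last by move=> v w vB /(B0_out vB)[].
  apply: leq_sum => w _; rewrite [leqRHS]sum1_card sum1dep_card.
  apply: subset_leq_card; apply/subsetP=> v; rewrite inE.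
  by case/andP=> vB /(B0_out vB)[].
have : \sum_(v in H) t v <= \sum_(v in H | v \notin S1) charge v + #|B0|.
  have t0 u : (u \in H) && (u \in S1) -> t u = 0.
    rewrite !inE => /andP[_ /andP[_ /eqP au]]; apply: t_eq0; rewrite au.
    by move: k4; clear; lia.
  rewrite (bigID (mem S1)) /= [X in X + _]big1 ?add0n; last exact: t0.
  rewrite -sum1_card [X in _ <= _ + X](_ : _ = \sum_(v in H | v \notin S1) (v \in B0)).
    rewrite -big_split; apply: leq_sum => v /andP[vH _].
    case: (t_charge vH) => [[le _] | [av tv cv]]; first exact: leq_trans (leq_addr _ _).
    by rewrite tv inE vH av tv cv !eqxx.
  rewrite [RHS]big_mkcond [LHS]big_mkcond; apply: eq_bigr => v _; case: ifP => vB.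
    by rewrite (subsetP B0H v vB) (disjointFr B0S1 vB).
  by case: ifP.
move/(leq_trans charge_sum); rewrite (bigID (mem S1)) /= addnC leq_add2l.
rewrite (eq_bigl (fun v => v \in S1)) => [le|v]; last first.
  by rewrite andbC; case vS: (v \in S1); rewrite // (subsetP S1H v vS).
apply/eqP; rewrite -cards_eq0; have := leq_trans count le; move: k4; clear; nia.
Qed.

(** Now [t] is at most [charge] at every vertex, and [charge_sum] is the reverse inequality in
    total; so equality holds everywhere, which [t_charge] allows only at 0. *)
Lemma charge_zero v : v \in H -> charge v = 0 /\ t v = 0.
Proof.
have tc v1 : v1 \in H -> t v1 <= charge v1 /\ (t v1 = charge v1 -> charge v1 = 0).
  move=> vH; case: (t_charge vH) => [// | [av tv cv]].
  by have /setP/(_ v1) := B0_empty; rewrite !inE vH av tv cv !eqxx.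
move=> vH; have tE := leq_sum_eq (fun i iH => proj1 (tc i iH)) charge_sum vH.
by have [_ c0] := tc v vH; rewrite tE (c0 tE).
Qed.

(** With digons and surplus gone, [farc_sum] bounds each sum by [k]; by [deg_split] the average is
    [k], so each bound is attained. *)
Lemma regular_core :
  [/\ {in H, forall v, deg v = k}, {in H, forall v, o v = a v}, {in H, forall v, d v = 0}
    & forall u x, farc u x -> a u + a x = k].
Proof.
split=> [v vH|v vH|v vH|u x fux].
- by have [] := charge_eq0 vH (charge_zero vH).1.
- by have [] := charge_eq0 vH (charge_zero vH).1.
- by have [] := charge_eq0 vH (charge_zero vH).1.
have fl u1 x1 : farc u1 x1 -> u1 \in H by case/and4P.
have fr u1 x1 : farc u1 x1 -> x1 \in H by case/and4P.
have le p : farc p.1 p.2 -> a p.1 + a p.2 <= k.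
  move=> fp; have := farc_sum fp; have uH := fl _ _ fp; have xH := fr _ _ fp.
  have [_ _ du] := charge_eq0 uH (charge_zero uH).1.
  rewrite (negPf (digon_free fp du)) addn0.
  case: (boolP (surplus _ _)) => [sp|_]; last by rewrite addn0.
  have [_ /eqP] := charge_zero xH; rewrite cards_eq0 => /eqP/setP/(_ p.1).
  by rewrite !inE sp.
apply: (@leq_sum_eq _ (fun p => farc p.1 p.2) (fun p => a p.1 + a p.2) (fun=> k) _ _ (u, x)) => //.
rewrite big_split /= (@sum_pair_l _ H farc (fun u x => a u)) // (@sum_pair_r _ H farc (fun u x => a x)) //.
rewrite (@sum_pair_l _ H farc (fun u x => k)) // -big_split /=.
apply: leq_sum => v vH; have [dg oa d0] := charge_eq0 vH (charge_zero vH).1.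
have := deg_split vH; rewrite dg d0 addn0 !sum_nat_const /o /i !cardsE -mulnDl => ->.
by rewrite -oa /o cardsE mulnC.
Qed.

Lemma not_slack_core : False.
Proof.
have [degk oa d0 sumk] := regular_core.
have comp := brooks (@core_adj_sym _ O) (core_adj_irr O_irr) (ltnW k4) Hcrit degk.
have totO : {in H &, forall x y, x != y -> O x y || O y x}.
  by move=> x y xH yH xy; have := core_adj_adj (comp x y xH yH xy); rewrite /adj.
have fa x y : x \in H -> y \in H -> O x y -> farc x y.
  move=> xH yH Oxy; rewrite /farc xH yH Oxy andbT /=; apply: comp => //.
  by apply: contraTneq Oxy => ->; rewrite O_irr.
have sumk2 x y : x \in H -> y \in H -> x != y -> a x + a y = k.
  move=> xH yH xy; case/orP: (totO x y xH yH xy) => Oxy; first exact/sumk/fa.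
  by rewrite addnC; apply/sumk/fa.
have [v vH] : exists v, v \in H.
  apply/set0Pn; apply: contraNneq (proj1 Hcrit) => ->; apply/kcolP.
  by exists (fun=> Ordinal (ltnW (ltnW (ltnW k4)))) => x y; rewrite inE.
have cH : #|H| = k.+1.
  rewrite (cardsD1 v) vH -(degk v vH); congr _.+1; apply: eq_card => y.
  rewrite !inE andbC; case yH: (y \in H); rewrite ?andbF //=.
  have [->|yv] := eqVneq y v; first by rewrite core_adj_irr.
  by rewrite comp // eq_sym.
have third x y : exists2 z, z \in H & (z != x) && (z != y).
  have : 0 < #|H :\ x :\ y|.
    by have := cardsD1 x H; have := cardsD1 y (H :\ x); rewrite cH; move: k4; clear; lia.
  by case/card_gt0P=> z; rewrite !inE => /and3P[zy zx zH]; exists z; rewrite ?zx.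
(* Any two distinct vertices have out-degrees adding up to [k]; comparing both [x] and [v] with a
   third vertex makes them equal. *)
have areg x : x \in H -> a x = a v.
  move=> xH; have [z zH /andP[zx zv]] := third x v.
  by have := sumk2 x z xH zH; have := sumk2 v z vH zH; rewrite eq_sym zv eq_sym zx; clear; lia.
apply: no_model; rewrite -cH.
apply: (tournament_kmodel O_irr totO _ _ areg).
- by move=> x y xH yH Oxy; apply: digon_free (d0 x xH); apply: fa.
- move=> x xH y Oxy; have /setP/(_ y) := closed_farc xH (oa x xH).
  by rewrite !inE Oxy => /and4P[].
have [z zH /andP[zv _]] := third v v.
by have := sumk2 v z vH zH; rewrite (areg z zH) eq_sym zv; move: k4; clear; lia.
Qed.

End Counting.

Lemma slack_core_kmodel (V : finType) (O : rel V) (k : nat) (H : {set V}) :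
    irreflexive O -> 3 < k -> crit (core_adj O) k H ->
    {in H, forall v, slack O k v} ->
  has_kmodel (arc_adj O) k.+1.
Proof.
move=> O_irr k4 Hcrit Hslack; apply: contrapT.
exact: not_slack_core Hslack.
Qed.

(** * Reduction to a critical set *)

Lemma rainbow_colouring (V : finType) (O : rel V) (k : nat) (R : {set V}) (c : V -> 'I_k) :
    {in R &, forall u v, ~~ core_adj O u v} ->
    {in R, forall v, #|core_nbrs O v| <= k /\ out O v \subset core_nbrs O v} ->
    proper_on (core_adj O) (~: R) c ->
  kcol (arc_adj O) k setT.
Proof.
move=> R_indep R_small cP.
pose free v := [pick i | i \notin c @: core_nbrs O v].
pose col (p : V * V) := if p.1 \in R then odflt (c p.2) (free p.1) else c p.1.
have coreE p q : arc_adj O p q -> core_adj O p.1 q.1.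
  case/and5P=> Op Oq pq p2 q2; rewrite /core_adj pq /=.
  by apply/andP; split; apply/existsP; [exists p.2; rewrite Op | exists q.2; rewrite Oq].
have half p q : arc_adj O p q -> p.1 \in R -> col p != col q.
  move=> pq pR; have cpq := coreE p q pq; have qR : q.1 \notin R.
    by apply/negP=> qR; have := R_indep _ _ pR qR; rewrite cpq.
  rewrite /col pR (negPf qR) /free; case: pickP => [i /= iN | full].
    by apply: contraNneq iN => ->; apply: imset_f; rewrite inE.
  have [Nk outN] := R_small _ pR; have /and5P[Op _ _ p2 _] := pq; rewrite /=.
  (* When no colour is missing, the at most [k] core neighbours carry all [k] colours, each once; so
     the colour of the head of [p] differs from that of the tail of [q]. *)
  have cinj : {in core_nbrs O p.1 &, injective c}.
    apply/imset_injP; rewrite eqn_leq leq_imset_card /=; apply: leq_trans Nk _.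
    rewrite -{1}[k]card_ord -cardsT; apply: subset_leq_card; apply/subsetP=> i _.
    by have := full i; rewrite /= => /negbFE.
  apply: contraNneq p2 => /cinj-> //; first by apply: (subsetP outN); rewrite inE.
  by rewrite inE.
apply/kcolP; exists col => p q _ _ pq.
have [pR | pR] := boolP (p.1 \in R); first exact: half.
have [qR | qR] := boolP (q.1 \in R); first by rewrite eq_sym half // arc_adj_sym.
by rewrite /col (negPf pR) (negPf qR); apply: cP; rewrite ?inE //; apply: coreE.
Qed.

Lemma arc_adj_hadwiger (V : finType) (O : rel V) (k : nat) :
    irreflexive O -> 3 < k -> ~~ kcol (arc_adj O) k setT ->
  has_kmodel (arc_adj O) k.+1.
Proof.
move=> O_irr k4 nX.
pose tame v := (#|core_nbrs O v| <= k) && (out O v \subset core_nbrs O v).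
pose indep (R : {set V}) :=
  [forall u in R, tame u && [forall v in R, ~~ core_adj O u v]].
have indepP (R : {set V}) : reflect ({in R, forall u, tame u} /\ {in R &, forall u v, ~~ core_adj O u v}) (indep R).
  apply: (iffP forall_inP) => [h | [h1 h2] u uR].
    by split=> [u /h/andP[] | u v /h/andP[_ /forall_inP]] //; apply.
  by rewrite (h1 u uR) /=; apply/forall_inP=> v vR; apply: h2.
have indep0 : indep set0 by apply/indepP; split=> u; rewrite inE.
have [R /maxsetP[/indepP[R_tame R_indep] R_max] _] := maxset_exists indep0.
have nR : ~~ kcol (core_adj O) k (~: R).
  apply: contra nX => /kcolP[c cP]; apply: rainbow_colouring R_indep _ cP.
  by move=> v /R_tame/andP[].
have [H HR Hcrit] := crit_exists nR.
apply: (slack_core_kmodel O_irr k4 Hcrit) => v vH.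
have vR : v \notin R by move/(subsetP HR): vH; rewrite inE.
have sub : nbr (core_adj O) H v \subset core_nbrs O v.
  by apply/subsetP=> x; rewrite !inE => /andP[].
have kv := crit_deg (@core_adj_sym _ O) (core_adj_irr O_irr) Hcrit vH.
split; first exact: leq_trans (subset_leq_card sub).
have [tv | ] := boolP (tame v); last first.
  by rewrite negb_and -ltnNge => /orP[|/subsetPn[y]]; [left | right; exists y].
(* A tame [v] outside the maximal set [R] has a core neighbour in [R]; it lies outside [H], hence
   comes on top of the [k] neighbours inside [H]. *)
left; apply: leq_ltn_trans kv (proper_card _); rewrite properE sub /=.
have [/exists_inP[r rR vr] | /exists_inPn nr] := boolP [exists r in R, core_adj O v r].
  apply/subsetPn; exists r; first by rewrite inE.
  by rewrite inE; apply/negP=> /andP[/(subsetP HR)]; rewrite inE rR.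
have /R_max/(_ (subsetUr _ _))/setP/(_ v) : indep (v |: R); last by rewrite !inE eqxx (negPf vR).
apply/indepP; split=> [u | u w].
  by rewrite !inE => /predU1P[-> | /R_tame].
rewrite !inE => /predU1P[-> | uR] /predU1P[-> | wR]; first by rewrite core_adj_irr.
- exact: nr.
- by rewrite core_adj_sym nr.
exact: R_indep.
Qed.

(** * Transfer to 3-arc graphs of digraphs *)

Lemma colorableE (G : sgraph) k : colorable G k = kcol (@sedge G) k setT.
Proof.
apply: eq_existsb => c; apply/forallP/forall_inP => [h x _ | h x].
  by apply/forall_inP=> y _; apply: (forallP (h x)).
by apply/forallP=> y; apply: (forall_inP (h x (in_setT x))).
Qed.

Lemma not_colorable_inh (G : sgraph) k : ~~ colorable G k -> exists x : G, x \in G.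
Proof.
move=> nG; apply/existsP; apply: contraR nG => /existsPn G0.
apply/existsP; unshelve eexists; first by apply: finfun => x; case/negP: (G0 x).
by apply/forallP=> x; case/negP: (G0 x).
Qed.

Lemma kmodel_small_chromatic (G : sgraph) k :
  k <= 3 -> ~~ colorable G k -> has_kmodel (@sedge G) k.+1.
Proof.
move=> k3 nG; have [x0 _] := not_colorable_inh nG.
have kmodel (H : {set G}) : H != set0 -> {in H, forall x, k <= #|nbr (@sedge G) H x|} ->
    has_kmodel (@sedge G) k.+1.
  exact: (kmodel_small x0 (@sedge_sym G) (@sedge_irr G) k3).
(* With 0 colours not even the empty set is colourable, so a critical set could be empty; this case
   is treated directly. *)
case: k {k3} nG kmodel => [|k] nG kmodel.
  by apply: (kmodel setT) => //; apply/set0Pn; exists x0.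
have [H _ Hcrit] : exists2 H : {set G}, H \subset setT & crit (@sedge G) k.+1 H.
  by apply: crit_exists; rewrite -colorableE.
apply: (kmodel H) => [|x xH]; last exact: (crit_deg (@sedge_sym G) (@sedge_irr G) Hcrit xH).
apply: contraNneq (proj1 Hcrit) => ->; apply/kcolP.
by exists (fun=> ord0) => x y; rewrite inE.
Qed.

(** Parallel arcs have the same neighbours and are never adjacent. So a colouring of the pairs pulls
    back along [h], and a model on pairs is carried over by choosing with [s] one arc for each
    pair. *)
Lemma three_arc_kmodel (D : digraph) k :
  3 < k -> ~~ colorable (three_arc_graph D) k ->
  has_kmodel (@sedge (three_arc_graph D)) k.+1.
Proof.
move=> k4 nD; have [a0 _] := not_colorable_inh nD.
pose O u v := [exists a : Defs.arc D, (arc_tail a == u) && (arc_head a == v)].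
have O_irr : irreflexive O.
  move=> u; apply/existsP=> -[a /andP[/eqP ta /eqP ha]].
  by move: (loopless a); rewrite ta ha eqxx.
have adjE u v : adj O u v = dadjacent u v.
  apply/orP/existsP => [[] /existsP[a av] | [a /orP[] av]].
  - by exists a; rewrite av.
  - by exists a; rewrite av orbT.
  - by left; apply/existsP; exists a.
  by right; apply/existsP; exists a.
pose h (a : Defs.arc D) := (arc_tail a, arc_head a).
pose s (p : dvertex D * dvertex D) : Defs.arc D :=
  odflt a0 [pick a : Defs.arc D | (arc_tail a == p.1) && (arc_head a == p.2)].
have sP p : O p.1 p.2 -> arc_tail (s p) = p.1 /\ arc_head (s p) = p.2.
  case/existsP=> a ap; rewrite /s; case: pickP => [b /andP[/eqP-> /eqP->] // | /(_ a)].
  by rewrite ap.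
have Oh a : O (arc_tail a) (arc_head a) by apply/existsP; exists a; rewrite !eqxx.
apply: (has_kmodel_section (e := arc_adj O) (D := fun p => O p.1 p.2) (h := h) (s := s)).
- by move=> p /sP[tp hp]; rewrite /h tp hp -surjective_pairing.
- move=> p q /and5P[Op Oq pq p2 q2]; split=> //.
  have [tp hp] := sP p Op; have [tq hq] := sP q Oq.
  by rewrite /= /three_arc_edge tp hp tq hq p2 q2 -adjE.
- exact: ltnW (ltnW (ltnW k4)).
apply: (arc_adj_hadwiger O_irr k4); apply: contra nD => /kcolP[c cP].
rewrite colorableE; apply/kcolP; exists (c \o h) => a b _ _ /and3P[ab ba adj_ab].
by apply: cP; rewrite ?inE // /arc_adj /= !Oh adjE adj_ab ab.
Qed.

Theorem theorem1 (D : digraph) :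
  hadwiger_number (three_arc_graph D) >= chromatic_number (three_arc_graph D).
Proof.
rewrite /hadwiger_number /chromatic_number.
case: ex_minnP => -[|k] _ chi_min; case: ex_maxnP => // h _; apply.
have nD : ~~ colorable (three_arc_graph D) k.
  by apply/negP=> /chi_min; rewrite ltnn.
apply/asboolP; apply: has_kmodel_minor; case: (leqP k 3) => k3.
  exact: kmodel_small_chromatic.
exact: three_arc_kmodel.
Qed.
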